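(* Let $k$ be a field, $U$ a $4$-dimensional $k$-vector space, $P=\mathrm{Sym}_\bullet U$, $\Phi_3\in D_3U^*$, and $\mathfrak A=P/\operatorname{ann}\Phi_3$. Assume that $\operatorname{ann}\Phi_3$ contains no nonzero linear form and that $x\in U$ is a weak Lefschetz element on $\mathfrak A$. Fix $x^*\in U^*$ with $x^*(x)=1$, put $U_0=\ker x^*$, and fix a basis $y,z,w$ of $U_0$. Let $\mathrm{SM}$ be the $3\times3$ symmetric matrix over $k$ defined in the context. Assume that $\mathrm{SM}$ has rank one and, moreover, that $$\mathrm{SM}=\begin{bmatrix}\alpha&0&0\\0&0&0\\0&0&0\end{bmatrix}\quad\text{for some nonzero }\alpha\in k.$$ Let $E_1,E_2,E_3,E_4$ be the matrices defined in the context. Then the minimal homogeneous resolution of $\mathfrak A$ by free $P$-modules is $$0\to P\xrightarrow{E_4}P^7\xrightarrow{E_3}P^{12}\xrightarrow{E_2}P^7\xrightarrow{E_1}P.$$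
   Context: Setting. $\otimes=\otimes_k$, $U^*=\mathrm{Hom}_k(U,k)$. $P=\mathrm{Sym}_\bullet U$ is the standard graded polynomial ring and $D_\bullet U^*$ is the divided power algebra, with $D_iU^*=\mathrm{Hom}_k(\mathrm{Sym}_iU,k)$. $D_\bullet U^*$ is a $P$-module: for $u\in\mathrm{Sym}_aU$, $\nu\in D_bU^*$, $u\nu=u(\nu)\in D_{b-a}U^*$ is given by $(u\nu)(u')=\nu(uu')$ for $u'\in\mathrm{Sym}_{b-a}U$ (and $u\nu=0$ if $a>b$). $\operatorname{ann}\Phi=\{f\in P: f\Phi=0\}$. An element $\ell\in U$ is a weak Lefschetz element on $\mathfrak A$ if multiplication by $\ell$, $\mathfrak A_i\to\mathfrak A_{i+1}$, has maximal rank for every $i$. Let $p:U\to U^*$ be $p(u)=u(x\Phi_3)$; under the hypotheses it is an isomorphism. $U_0=\ker x^*$ (so $U=kx\oplus U_0$) and $U_0^*=\{f\in U^*: f(x)=0\}$; $y^*,z^*,w^*$ is the basis of $U_0^*$ dual to $y,z,w$. $\mathrm{proj}:\mathrm{Sym}_\bullet U\to\mathrm{Sym}_\bullet U_0$ is induced by $U=kx\oplus U_0$. For $\nu\in U_0^*$ and $a,b\in U_0$, $\nu(a\wedge b)=\nu(a)b-\nu(b)a\in U_0$. $\mathrm{ev}:U_0\otimes U_0^*\to k$ is evaluation and $\mathrm{ev}^*(1)=y\otimes y^*+z\otimes z^*+w\otimes w^*$. The matrix $\mathrm{SM}$. Let $\langle u,u'\rangle=[u\,p^{-1}(u'\Phi_3)](\Phi_3)$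 for $u,u'\in\mathrm{Sym}_2U_0$ (a symmetric bilinear form). Then $$\mathrm{SM}=\begin{bmatrix}\langle z^2,w^2\rangle-\langle zw,zw\rangle&\langle zw,yw\rangle-\langle yz,w^2\rangle&\langle yz,zw\rangle-\langle z^2,yw\rangle\\ \langle yw,zw\rangle-\langle yz,w^2\rangle&\langle y^2,w^2\rangle-\langle yw,yw\rangle&\langle yz,yw\rangle-\langle y^2,zw\rangle\\ \langle yz,zw\rangle-\langle yw,z^2\rangle&\langle yw,yz\rangle-\langle y^2,zw\rangle&\langle y^2,z^2\rangle-\langle yz,yz\rangle\end{bmatrix}.$$ Maps (all extended $P$-linearly; $u\in U_0$, $\nu\in U_0^*$, $u_2\in\mathrm{Sym}_2U_0$): $f_{1,1}:P\otimes U_0^*\to P$, $\nu\mapsto x\,p^{-1}(\nu)$. $f_{1,2}:P\otimes\mathrm{Sym}_2U_0\to P$, $u_2\mapsto u_2-x\,p^{-1}(u_2\Phi_3)$. $\mathcal A:P\otimes \ker(\mathrm{ev})\to P\otimes U_0^*$ is induced by $u\otimes\nu\mapsto -x\otimes[u\,p^{-1}(\nu)](\Phi_3)+u\otimes\nu$ (on $\ker(\mathrm{ev})$ the values lie in $P\otimes U_0^*$). $\mathcal B:\frac{U_0\otimes U_0^*}{\mathrm{ev}^*(1)}\to U_0^*$ sends the class of $u\otimes\nu$ to $-[y\,p^{-1}((\nu(z\wedge w)u)(\Phi_3))](\Phi_3)+[z\,p^{-1}((\nu(y\wedge w)u)(\Phi_3))](\Phi_3)-[w\,p^{-1}((\nu(y\wedge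 z)u)(\Phi_3))](\Phi_3)$. $\mathcal C:\ker(\mathrm{ev})\to\mathrm{Sym}_2U_0$ is induced by $u\otimes\nu\mapsto -u\cdot\mathrm{proj}(p^{-1}(\nu))$. $\mathcal D:P\otimes \frac{U_0\otimes U_0^*}{\mathrm{ev}^*(1)}\to P\otimes\mathrm{Sym}_2U_0$ sends the class of $u\otimes\nu$ to $-x\otimes w\cdot\mathrm{proj}(p^{-1}([\nu(y\wedge z)u](\Phi_3)))+x\otimes z\cdot\mathrm{proj}(p^{-1}([\nu(y\wedge w)u](\Phi_3)))-x\otimes y\cdot\mathrm{proj}(p^{-1}([\nu(z\wedge w)u](\Phi_3)))-w\otimes\nu(y\wedge z)u+z\otimes\nu(y\wedge w)u-y\otimes\nu(z\wedge w)u$. Matrices. $f_{1,1}$ ($1\times3$), $f_{1,2}$ ($1\times6$), $A=(a_{i,j})$ ($3\times8$), $B=(b_{i,j})$ ($3\times8$), $C=(c_{i,j})$ ($6\times8$), $D=(d_{i,j})$ ($6\times8$) are the matrices of $f_{1,1},f_{1,2},\mathcal A,\mathcal B,\mathcal C,\mathcal D$ in the following ordered bases. $U_0^*$: $y^*,z^*,w^*$. $\mathrm{Sym}_2U_0$: $y^2,yz,yw,z^2,zw,w^2$. $\ker(\mathrm{ev})$: $y\otimes y^*-w\otimes w^*,\ y\otimes z^*,\ y\otimes w^*,\ z\otimes y^*,\ z\otimes z^*-w\otimes w^*,\ z\otimes w^*,\ w\otimes y^*,\ w\otimes z^*$. $\frac{U_0\otimes U_0^*}{\mathrm{ev}^*(1)}$: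 classes of $y\otimes y^*,\ z\otimes y^*,\ w\otimes y^*,\ y\otimes z^*,\ z\otimes z^*,\ w\otimes z^*,\ y\otimes w^*,\ z\otimes w^*$. Let $$\tilde d_1=\begin{bmatrix}x f_{1,1}&f_{1,2}\end{bmatrix}\ (1\times 9),\qquad \tilde d_2=\begin{bmatrix}A&B\\ x^2C&D\end{bmatrix}\ (9\times16).$$ Let $D_{*,j}$ be column $j$ of $D$, and $$\theta_1=\left[\begin{array}{ccc|c}1&0&0&\\ 0&0&\alpha&0_{3\times6}\\ 0&-\alpha&0&\\ \hline 0_{6\times1}&D_{*,2}&D_{*,3}&I_6\end{array}\right],\qquad \theta_2=\begin{bmatrix}I_8&0_{8\times8}\\ M&I_8\end{bmatrix},$$ $$M=\frac1\alpha\begin{bmatrix}0&-a_{3,1}&a_{2,1}&0&0&0&0&0\\ a_{3,1}&0&a_{3,3}&a_{3,4}&a_{3,5}&a_{3,6}&a_{3,7}&a_{3,8}\\ -a_{2,1}&-a_{2,2}&0&-a_{2,4}&-a_{2,5}&-a_{2,6}&-a_{2,7}&-a_{2,8}\\ 0&-a_{3,4}&a_{2,4}&0&0&0&0&0\\ 0&-a_{3,5}&a_{2,5}&0&0&0&0&0\\ 0&-a_{3,6}&a_{2,6}&0&0&0&0&0\\ 0&-a_{3,7}&a_{2,7}&0&0&0&0&0\\ 0&-a_{3,8}&a_{2,8}&0&0&0&0&0\end{bmatrix},\qquad J=\begin{bmatrix}0_{6\times6}&I_6\\ I_6&0_{6\times6}\end{bmatrix}.$$ $E_1$ is $\tilde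 d_1\theta_1$ with columns $2,3$ deleted; $E_2$ is $\theta_1^{-1}\tilde d_2\theta_2$ with rows $2,3$ and columns $2,3,10,11$ deleted; $E_3=J E_2^{T}$; $E_4=E_1^{T}$. *)

(* Defs.v *)
From mathcomp Require Import all_boot all_order all_algebra.
From mathcomp Require Import mpoly.

Set Implicit Arguments.
Unset Strict Implicit.
Unset Printing Implicit Defensive.

Import GRing.Theory.
Local Open Scope ring_scope.

(* Free resolutions over a polynomial ring.  Matrices act on column vectors,
   so M : 'M_(m, n) is a map P^n -> P^m. *)

Section Resolutions.

Variables (k : fieldType) (N : nat).
Local Notation P := {mpoly k[N]}.

(* M is a degree-0 map from the sum of the P(-b j) to the sum of the
   P(-a i). *)
Definition homogeneous_mx m n (a : 'I_m -> nat) (b : 'I_n -> nat)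
    (M : 'M[P]_(m, n)) : Prop :=
  forall i j, M i j = 0 \/ (a i <= b j)%N /\ M i j \is (b j - a i)%N.-homog.

(* All entries lie in the irrelevant maximal ideal. *)
Definition minimal_mx m n (M : 'M[P]_(m, n)) : Prop :=
  forall i j, (M i j)@_0%MM = 0.

Definition exact_at m n p (M : 'M[P]_(m, n)) (M' : 'M[P]_(n, p)) : Prop :=
  forall v : 'cV[P]_n, M *m v = 0 <-> exists u : 'cV[P]_p, v = M' *m u.

(* 0 -> P^n4 -M4-> P^n3 -M3-> P^n2 -M2-> P^n1 -M1-> P is a minimal
   homogeneous resolution of P / I. *)
Definition minimal_homogeneous_resolution4 (I : P -> Prop) n1 n2 n3 n4
    (M1 : 'M[P]_(1, n1)) (M2 : 'M[P]_(n1, n2))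
    (M3 : 'M[P]_(n2, n3)) (M4 : 'M[P]_(n3, n4)) : Prop :=
  [/\ exists (s1 : 'I_n1 -> nat) (s2 : 'I_n2 -> nat)
             (s3 : 'I_n3 -> nat) (s4 : 'I_n4 -> nat),
        [/\ homogeneous_mx (fun=> 0%N) s1 M1, homogeneous_mx s1 s2 M2,
            homogeneous_mx s2 s3 M3 & homogeneous_mx s3 s4 M4],
      [/\ minimal_mx M1, minimal_mx M2, minimal_mx M3 & minimal_mx M4],
      forall f : P, I f <-> exists u : 'cV[P]_n1, f%:M = M1 *m u,
      [/\ exact_at M1 M2, exact_at M2 M3 & exact_at M3 M4] &
      forall v : 'cV[P]_n4, M4 *m v = 0 -> v = 0].

End Resolutions.

(* Sym U is {mpoly k[\dim {:U}]}, the polynomials in the library's chosen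
   basis of U; inSym is the inclusion of U = Sym_1 U, and Sym_d U is the set of
   d.-homog polynomials. *)
Definition inSym (k : fieldType) (U : vectType k) (u : U) :
    {mpoly k[\dim {:U}]} :=
  \sum_(i < \dim {:U}) coord (vbasis {:U}) i u *: 'X_i.

Section InverseSystem.

Variables (k : fieldType) (U : vectType k).
Local Notation P := {mpoly k[\dim {:U}]}.

(* D_b U^* = Hom(Sym_b U, k), a linear form on Sym_b U being extended by zero
   to the other graded components of Sym U. *)
Definition in_D (b : nat) (nu : P -> k) : Prop :=
  forall d f, d != b -> f \is d.-homog -> nu f = 0.

(* The action of P on divided powers: with the extension by zero,
   (f nu)(g) = nu (f g) also covers the case deg f > b, where f nu = 0. *)
Definition contract (f : P) (nu : P -> k) : P -> k := fun g => nu (f * g).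

Definition ann (Phi : P -> k) (f : P) : Prop :=
  forall g, contract f Phi g = 0.

(* Multiplication by u, from degree i to degree i + 1 of P / ann Phi, is
   injective or surjective for every i. *)
Definition weak_Lefschetz (Phi : P -> k) (u : U) : Prop :=
  forall i : nat,
    (forall f, f \is i.-homog -> ann Phi (inSym u * f) -> ann Phi f) \/
    (forall g, g \is i.+1.-homog ->
       exists2 f, f \is i.-homog & ann Phi (g - inSym u * f)).

End InverseSystem.

Section Matrices.

Variables (k : fieldType) (U : vectType k).
Local Notation P := {mpoly k[\dim {:U}]}.
Local Notation dualU := 'Hom(U, k^o).

Variables (Phi : {linear P -> k^o}) (xs : dualU) (x y z w : U).

Local Notation X := (inSym x).

(* f Phi in D_1 U^* = U^*, for f in Sym_2 U. *)
Definition to_dual (f : P) : dualU :=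
  linfun (fun v : U => contract f Phi (inSym v) : k^o).

Definition p_map : 'Hom(U, dualU) :=
  linfun (fun u : U => to_dual (inSym u * X)).

(* The inverse of p_map whenever p_map is bijective. *)
Definition pinv (nu : dualU) : U := (p_map^-1)%VF nu.

(* The bracket <u, u'>; f Phi in D_0 U^* = k is the scalar Phi f when f is
   in Sym_3 U. *)
Definition bracket (u u' : P) : k := Phi (u * inSym (pinv (to_dual u'))).

Definition SM : 'M[k]_3 :=
  let y2 := inSym y * inSym y in let yz := inSym y * inSym z in
  let yw := inSym y * inSym w in let z2 := inSym z * inSym z in
  let zw := inSym z * inSym w in let w2 := inSym w * inSym w in
  let b := bracket in
  \matrix_(i < 3, j < 3) nth 0 (nth [::]
   [:: [:: b z2 w2 - b zw zw; b zw yw - b yz w2; b yz zw - b z2 yw];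
       [:: b yw zw - b yz w2; b y2 w2 - b yw yw; b yz yw - b y2 zw];
       [:: b yz zw - b yw z2; b yw yz - b y2 zw; b y2 z2 - b yz yz]] i) j.

Definition yzw (i : 'I_3) : U := tnth [tuple y; z; w] i.

(* y*, z*, w* as forms on U vanishing at x. *)
Definition yzw_dual (i : 'I_3) : dualU :=
  linfun (fun u : U => coord [tuple x; y; z; w] (lift ord0 i) u : k^o).

(* U -> U_0 along k x *)
Definition projU0 (v : U) : U := v - (xs v : k) *: x.

(* nu (a /\ b) *)
Definition wedge_eval (nu : dualU) (a b : U) : U :=
  (nu a : k) *: b - (nu b : k) *: a.

(* Coordinates in y*, z*, w*: the x*-component, which is dropped, vanishes on
   the values of A (on the kernel of ev) and B. *)
Definition dual_coord (nu : dualU) : 'cV[k]_3 := \col_i (nu (yzw i) : k).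

(* The basis y^2, yz, yw, z^2, zw, w^2 of Sym_2 U_0. *)
Definition sym2_index (r : 'I_6) : 'I_3 * 'I_3 :=
  let o (n : nat) : 'I_3 := inord n in
  tnth [tuple (o 0, o 0); (o 0, o 1); (o 0, o 2);
              (o 1, o 1); (o 1, o 2); (o 2, o 2)] r.

(* Coordinates in that basis of the product a b of elements a, b of U_0. *)
Definition sym2_coord (a b : U) : 'cV[k]_6 :=
  let c (i : 'I_3) (u : U) : k := yzw_dual i u in
  \col_r let: (i, j) := sym2_index r in
    if i == j then c i a * c i b else c i a * c j b + c j a * c i b.

(* f (x) v in P (x) V, for V with coordinates in k^m *)
Definition tens m (f : P) (v : 'cV[k]_m) : 'cV[P]_m :=
  \col_i (f * (v i ord0)%:MP).

Definition f11 : 'M[P]_(1, 3) := \row_j (X * inSym (pinv (yzw_dual j))).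

Definition f12 : 'M[P]_(1, 6) :=
  \row_r let: (i, j) := sym2_index r in
    inSym (yzw i) * inSym (yzw j)
      - X * inSym (pinv (to_dual (inSym (yzw i) * inSym (yzw j)))).

(* The maps A, B, C, D on a pure tensor u (x) nu, in coordinates. *)
Definition mapA (u : U) (nu : dualU) : 'cV[P]_3 :=
  - tens X (dual_coord (to_dual (inSym u * inSym (pinv nu))))
  + tens (inSym u) (dual_coord nu).

Definition mapB (u : U) (nu : dualU) : 'cV[k]_3 :=
  let q (a b : U) :=
    inSym (pinv (to_dual (inSym (wedge_eval nu a b) * inSym u))) in
  - dual_coord (to_dual (inSym y * q z w))
  + dual_coord (to_dual (inSym z * q y w))
  - dual_coord (to_dual (inSym w * q y z)).

Definition mapC (u : U) (nu : dualU) : 'cV[k]_6 :=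
  - sym2_coord u (projU0 (pinv nu)).

Definition mapD (u : U) (nu : dualU) : 'cV[P]_6 :=
  let q (a b : U) :=
    projU0 (pinv (to_dual (inSym (wedge_eval nu a b) * inSym u))) in
  - tens X (sym2_coord w (q y z))
  + tens X (sym2_coord z (q y w))
  - tens X (sym2_coord y (q z w))
  - tens (inSym w) (sym2_coord (wedge_eval nu y z) u)
  + tens (inSym z) (sym2_coord (wedge_eval nu y w) u)
  - tens (inSym y) (sym2_coord (wedge_eval nu z w) u).

(* An element of U_0 (x) U_0^* is given as a list of pure tensors, to be
   summed. *)
Definition ker_ev_basis : seq (seq (U * dualU)) :=
  let ys := yzw_dual (inord 0) in
  let zs := yzw_dual (inord 1) in
  let ws := yzw_dual (inord 2) in
  [:: [:: (y, ys); (- w, ws)]; [:: (y, zs)]; [:: (y, ws)]; [:: (z, ys)];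
      [:: (z, zs); (- w, ws)]; [:: (z, ws)]; [:: (w, ys)]; [:: (w, zs)]].

(* Representatives of the basis of the quotient of U_0 (x) U_0^* by ev^*(1). *)
Definition quot_basis : seq (seq (U * dualU)) :=
  let ys := yzw_dual (inord 0) in
  let zs := yzw_dual (inord 1) in
  let ws := yzw_dual (inord 2) in
  [:: [:: (y, ys)]; [:: (z, ys)]; [:: (w, ys)]; [:: (y, zs)];
      [:: (z, zs)]; [:: (w, zs)]; [:: (y, ws)]; [:: (z, ws)]].

Definition tensor_mx (R : nzRingType) m (F : U -> dualU -> 'cV[R]_m)
    (basis : seq (seq (U * dualU))) : 'M[R]_(m, 8) :=
  \matrix_(i < m, j < 8) (\sum_(t <- nth [::] basis j) F t.1 t.2) i ord0.

Definition toP m n (M : 'M[k]_(m, n)) : 'M[P]_(m, n) :=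
  map_mx (@mpolyC _ _) M.

Definition mxA : 'M[P]_(3, 8) := tensor_mx mapA ker_ev_basis.
Definition mxB : 'M[P]_(3, 8) := toP (tensor_mx mapB quot_basis).
Definition mxC : 'M[P]_(6, 8) := toP (tensor_mx mapC ker_ev_basis).
Definition mxD : 'M[P]_(6, 8) := tensor_mx mapD quot_basis.

Definition d1 : 'M[P]_(1, 3 + 6) := row_mx (X *: f11) f12.

Definition d2 : 'M[P]_(3 + 6, 8 + 8) := block_mx mxA mxB (X ^+ 2 *: mxC) mxD.

Variable alpha : k.

Definition theta1 : 'M[P]_(3 + 6) :=
  let al : P := alpha%:MP in
  block_mx
    (\matrix_(i < 3, j < 3) nth 0 (nth [::]
      [:: [:: 1;    0;  0];
          [:: 0;    0; al];
          [:: 0; - al;  0]] i) j)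
    0
    (row_mx (0 : 'cV_6) (row_mx (col (inord 1) mxD) (col (inord 2) mxD)))
    1%:M.

Definition mxM : 'M[P]_8 :=
  let a (i j : nat) : P := mxA (inord i.-1) (inord j.-1) in
  (alpha^-1)%:MP *: \matrix_(i < 8, j < 8) nth 0 (nth [::]
   [:: [:: 0; - a 3 1; a 2 1; 0; 0; 0; 0; 0];
       [:: a 3 1; 0; a 3 3; a 3 4; a 3 5; a 3 6; a 3 7; a 3 8];
       [:: - a 2 1; - a 2 2; 0; - a 2 4; - a 2 5; - a 2 6; - a 2 7; - a 2 8];
       [:: 0; - a 3 4; a 2 4; 0; 0; 0; 0; 0];
       [:: 0; - a 3 5; a 2 5; 0; 0; 0; 0; 0];
       [:: 0; - a 3 6; a 2 6; 0; 0; 0; 0; 0];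
       [:: 0; - a 3 7; a 2 7; 0; 0; 0; 0; 0];
       [:: 0; - a 3 8; a 2 8; 0; 0; 0; 0; 0]] i) j.

Definition theta2 : 'M[P]_(8 + 8) := block_mx 1%:M 0 mxM 1%:M.

(* Indices are counted from 0: positions 1, 2 are dropped from 'I_9 and
   1, 2, 9, 10 from 'I_16. *)
Definition keep7 (i : 'I_7) : 'I_(3 + 6) :=
  (inord (nth 0 [:: 0; 3; 4; 5; 6; 7; 8] i) : 'I_9)%N.

Definition keep12 (j : 'I_(6 + 6)) : 'I_(8 + 8) :=
  (inord (nth 0 [:: 0; 3; 4; 5; 6; 7; 8; 11; 12; 13; 14; 15] j) : 'I_16)%N.

Definition E1 : 'M[P]_(1, 7) := colsub keep7 (d1 *m theta1).

Definition E2 : 'M[P]_(7, 6 + 6) :=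
  mxsub keep7 keep12 (invmx theta1 *m d2 *m theta2).

Definition mxJ : 'M[P]_(6 + 6) := block_mx 0 1%:M 1%:M 0.

Definition E3 : 'M[P]_(6 + 6, 7) := mxJ *m E2^T.

Definition E4 : 'M[P]_(7, 1) := E1^T.

End Matrices.

(* Main.v *)
(* The form (u, v) |-> Phi (u x v) on U is nondegenerate, so multiplication in
   degree two makes U a commutative, non-associative algebra with unit x:
   a ** b is the element with Phi ((a ** b) x c) = Phi (a b c).  SM measures
   its associator: y ** (z ** c) = z ** (y ** c), the same for y and w, while
   z ** (w ** c) and w ** (z ** c) differ by alpha times
   w^*(c) p^-1 z^* - z^*(c) p^-1 w^*, for c among y, z, w.

   The ideal ann Phi is generated by the a b - x (a ** b) and the
   x^2 p^-1(nu), i.e. by the entries of d1.  A syzygy of d1 is, modulo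
   the columns of d2, x times another syzygy, because the linear syzygies of
   (y, z, w)^2 generate all of them along the regular sequence x, y, z, w;
   graded Nakayama then gives exactness of d1, d2.  The rows of d2 are
   isotropic for the hyperbolic form on P^16, and theta2 is an isometry of that
   form.  After the base changes theta1, theta2 two rows of d2 become unit
   vectors; isotropy kills the opposite columns, so deleting these rows and
   columns keeps exactness, and E2 J E2^T = 0.

   The rest of the complex comes from self-duality.  For f in ann Phi there is a
   homotopy f = s0 E1 + E2 s1, so E2 has rank at least 6 over the fraction
   field; as E2 E3 = 0 and E3 = J E2^T, the kernel of E2 is generically the
   image of E3, and transposing the homotopy shows that f ker E2 lies in that
   image.  Starting from the forms of degree 4, which all lie in ann Phi, one
   divides by the regular sequence x, y, z to descend to f = 1. *)

From HB Require Import structures.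
Require Import Defs.
From mathcomp Require Import all_boot all_order all_algebra.
From mathcomp Require Import mpoly.
From mathcomp Require Import ring.

Set Implicit Arguments.
Unset Strict Implicit.
Unset Printing Implicit Defensive.

Import GRing.Theory.
Local Open Scope ring_scope.

(** * Self-dual complexes *)

Section SelfDual.

Variables (k : fieldType) (N : nat).
Local Notation P := {mpoly k[N]}.
Variables (n m : nat) (E1 : 'M[P]_(1, n.+1)) (E2 : 'M[P]_(n.+1, m)) (J : 'M[P]_m).
Let E3 := J *m E2^T.
Let E4 := E1^T.

Hypotheses (mE : m = (n + n)%N) (JJ : J *m J = 1%:M).
Hypothesis ex12 : exact_at E1 E2.
Hypothesis E2E3 : E2 *m E3 = 0.
Variables (x y z : P).
Hypotheses (x1 : x \is 1.-homog) (y1 : y \is 1.-homog) (z1 : z \is 1.-homog).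
Hypotheses (x0 : x != 0).
Hypothesis regy : forall f g, y * f = x * g -> exists h, f = x * h.
Hypothesis regz : forall f g h, z * f = x * g + y * h ->
  exists g' h', f = x * g' + y * h'.

Variable I : P -> Prop.
Hypothesis imE1 : forall f, I f <-> exists u : 'cV[P]_n.+1, f%:M = E1 *m u.
Variable s : nat.
Hypothesis homog_I : forall f, f \is s.-homog -> I f.

Lemma scale_mx_inj p (a : P) (v v' : 'cV[P]_p) : a != 0 -> a *: v = a *: v' -> v = v'.
Proof.
move=> a0 /matrixP e; apply/matrixP=> i j; have := e i j; rewrite !mxE.
exact: mulfI.
Qed.

(** Induction downwards from degree [s]: for f of degree d the products x f, y f, z f have degree d
    + 1, so [S] passes to f; degree 0 contains 1. *)
Lemma homog_descent (S : P -> Prop) :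
  (forall f, f \is s.-homog -> S f) ->
  (forall f, S (x * f) -> S (y * f) -> S (z * f) -> S f) -> S 1.
Proof.
move=> Hs Hd.
suff H: forall i, (i <= s)%N -> forall f, f \is (s - i).-homog -> S f.
  by apply: (H s) => //; rewrite subnn; apply: dhomog1.
elim=> [_|i IH lti] f hf; first by apply: Hs; rewrite -(subn0 s).
have e : (s - i = 1 + (s - i.+1))%N by rewrite add1n subnSK.
by apply: Hd; apply: (IH (ltnW lti)); rewrite e; apply: dhomogM.
Qed.

Lemma E1E2 : E1 *m E2 = 0.
Proof.
apply/matrixP=> i j.
have: E1 *m col j E2 = 0 by apply/ex12; exists (delta_mx j 0); rewrite colE.
by rewrite colE mulmxA -colE => /matrixP/(_ i 0); rewrite !mxE.
Qed.

Lemma E3E4 : E3 *m E4 = 0.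
Proof. by rewrite /E3 /E4 -mulmxA -trmx_mul E1E2 trmx0 mulmx0. Qed.

Lemma J_inj p (u v : 'M[P]_(m, p)) : J *m u = J *m v -> u = v.
Proof. by move/(congr1 (mulmx J)); rewrite !mulmxA JJ !mul1mx. Qed.

Hypothesis s_pos : (0 < N)%N.

Lemma E1_neq0 : E1 != 0.
Proof.
apply/eqP=> E10; have i0 : 'I_N by case: (N) s_pos => // N' _; exact: ord0.
have [|u] := (imE1 ('X_i0 ^+ s)).1.
  apply: homog_I; rewrite -[s in s.-homog]mul1n; apply: dhomogMn.
  by rewrite dhomogX /= mdeg1.
rewrite E10 mul0mx => /matrixP/(_ 0 0); rewrite !mxE eqxx mulr1n => /eqP.
by rewrite expf_eq0 -msize_poly_eq0 msizeX mdeg1 andbF.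
Qed.

Lemma E4_inj (p : nat) (v v' : 'M[P]_(1, p)) : E4 *m v = E4 *m v' -> v = v'.
Proof.
move/matrixP=> e; have /matrix0Pn[i [j nz]] := E1_neq0.
apply/matrixP=> a b; have := e j b; rewrite !mxE !big_ord1 !mxE.
by rewrite !ord1 => /mulfI -> //; rewrite -(ord1 i).
Qed.

(** As [J] is invertible, [v^T] kills E2, hence every syzygy of E1, in particular the Koszul ones.
    So v is generically proportional to [E1^T], and the descent clears the denominators. *)
Lemma ker_E3 (v : 'cV[P]_n.+1) : E3 *m v = 0 -> exists u, v = E4 *m u.
Proof.
move=> E3v; have E2v : v^T *m E2 = 0.
  rewrite -[RHS]trmx0 -[LHS]trmxK trmx_mul trmxK; congr (_^T).
  by apply: J_inj; rewrite mulmxA E3v mulmx0.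
(* The Koszul syzygy of the entries i and j of E1 lies in the image of E2, which [v^T] kills. *)
have sym i j : E1 0 i * v j 0 = E1 0 j * v i 0.
  have [|t] := (ex12 (E1 0 i *: delta_mx j 0 - E1 0 j *: delta_mx i 0)).1.
    apply/matrixP=> a b; rewrite mulmxBr -!scalemxAr -!colE !mxE !ord1.
    by rewrite mulrC subrr.
  move/(congr1 (mulmx v^T)); rewrite mulmxA E2v mul0mx => /matrixP/(_ 0 0).
  rewrite mulmxBr -!scalemxAr -!colE !mxE => /eqP.
  by rewrite subr_eq0 => /eqP.
pose S f := exists g : 'M[P]_1, f *: v = E4 *m g.
suff: S 1 by case=> g; rewrite scale1r => ->; exists g.
apply: homog_descent => [f /homog_I /imE1[u /matrixP/(_ 0 0)]|f].
  rewrite !mxE eqxx mulr1n => ef; exists (v^T *m u).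
  apply/matrixP=> i j; rewrite !mxE big_ord1 !mxE !ord1 ef mulr_suml mulr_sumr.
  by apply: eq_bigr => l _; rewrite !mxE mulrAC sym; ring.
case=> [g eg] [h eh] _.
(* E4 sends both sides to x y f v. Since y is regular modulo x, the factor x then divides g. *)
have: x *: h = y *: g.
  apply: E4_inj; rewrite -!scalemxAr -eg -eh !scalerA; congr (_ *: _); ring.
move/matrixP/(_ 0 0); rewrite !mxE => /esym/regy[q eq].
exists (q%:M); apply: (scale_mx_inj x0); rewrite scalerA eg scalemxAr.
by congr (_ *m _); apply/matrixP=> a b; rewrite !mxE !ord1 eq eqxx mulr1n.
Qed.

Local Notation F := {fraction P}.
Local Notation "A ^F" := (map_mx (@tofrac P) A) (at level 8).

(** If f = E1 s0, then E1 kills each column of f - s0 E1, so each of these columns lifts through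
    E2. *)
Lemma homotopy (f : P) : I f -> exists s0 s1, f%:M = s0 *m E1 + E2 *m s1.
Proof.
case/imE1=> s0 e0; exists s0.
have H j : exists t : 'cV[P]_m, col j (f%:M - s0 *m E1) = E2 *m t.
  apply/ex12; rewrite colE mulmxA -colE mulmxBr mulmxA -e0.
  by rewrite mul_mx_scalar mul_scalar_mx subrr col0.
have [t et] := fin_all_exists H.
exists (\matrix_(i, j) t j i 0).
apply/eqP; rewrite addrC -subr_eq; apply/eqP/matrixP=> i j.
have /matrixP/(_ i 0) := et j; rewrite !mxE => ->.
by apply: eq_bigr => l _; rewrite !mxE.
Qed.

(** For f a power of a variable, the homotopy writes an invertible matrix of size n + 1 over the
    fraction field as one of rank at most 1 plus one of rank at most that of E2. *)
Lemma rank_E2 : (n <= \rank (E2^F))%N.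
Proof.
have i0 : 'I_N by case: (N) s_pos => // N' _; exact: ord0.
have [|s0 [s1 e]] := @homotopy ('X_i0 ^+ s).
  apply: homog_I; rewrite -[s in s.-homog]mul1n; apply: dhomogMn.
  by rewrite dhomogX /= mdeg1.
have f0 : tofrac ('X_i0 ^+ s : P) != 0.
  by rewrite tofrac_eq0 expf_eq0 -msize_poly_eq0 msizeX mdeg1 andbF.
have := congr1 (fun A : 'M_n.+1 => \rank (A^F)) e.
rewrite map_scalar_mx map_mxD !map_mxM mxrank_unit; last first.
  by rewrite -unitfE in f0; rewrite -scalemx1 unitmxZ ?unitmx1.
move=> r; have := mxrank_add (s0^F *m E1^F) (E2^F *m s1^F); rewrite -r => le1.
have h1 : (\rank (s0^F *m E1^F) <= 1)%N.
  by apply: leq_trans (mxrankM_maxr _ _) (rank_leq_row _).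
have := leq_trans le1 (leq_add h1 (mxrankM_maxl _ _)).
by rewrite add1n ltnS.
Qed.

(** A dimension count: E3 has the rank of E2, which is at least n, while the kernel of E2 contains
    the image of E3 and has dimension 2n minus that rank. Transposes appear because [kermx] is a
    left kernel. *)
Lemma generic_ker_E2 (u : 'cV[P]_m) : E2 *m u = 0 ->
  exists a : 'cV[F]_n.+1, u^F = E3^F *m a.
Proof.
move=> E2u.
have uK : ((u^F)^T <= kermx (E2^F)^T)%MS.
  by apply/sub_kermxP; rewrite -trmx_mul -map_mxM E2u map_mx0 trmx0.
have E3K : ((E3^F)^T <= kermx (E2^F)^T)%MS.
  by apply/sub_kermxP; rewrite -trmx_mul -map_mxM E2E3 map_mx0 trmx0.
have rE3 : \rank (E3^F)^T = \rank (E2^F).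
  have Junit : J^F \in unitmx.
    by apply: (proj1 (mulmx1_unit (B := J^F) _)); rewrite -map_mxM JJ map_mx1.
  rewrite -row_full_unit in Junit.
  by rewrite mxrank_tr /E3 map_mxM (eqmxMfull _ Junit) -map_trmx mxrank_tr.
have : ((kermx (E2^F)^T) <= (E3^F)^T)%MS.
  rewrite -(geq_leqif (mxrank_leqif_sup E3K)) rE3 mxrank_ker mxrank_tr {1}mE.
  by rewrite leq_subLR leq_add ?rank_E2.
move/(submx_trans uK)/submxP=> [D eD]; exists D^T.
by apply: trmx_inj; rewrite trmx_mul trmxK.
Qed.

Lemma ker_E2 (u : 'cV[P]_m) : E2 *m u = 0 -> exists v, u = E3 *m v.
Proof.
move=> E2u; pose S f := exists v, f *: u = E3 *m v.
suff: S 1 by case=> v; rewrite scale1r => ->; exists v.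
apply: homog_descent => [f /homog_I If|f].
  have [s0 [s1 e]] := homotopy If.
  (* This is the transposed homotopy, with [J] moved across so that E3 replaces the transpose of
     E2. *)
  have [t1 t1E] : exists t1, t1 *m E3 = f%:M - E4 *m s0^T.
    exists (s1^T *m J); rewrite /E3 mulmxA -(mulmxA s1^T) JJ mulmx1 -trmx_mul.
    by rewrite /E4 -trmx_mul -[f%:M]tr_scalar_mx e linearD /= addrC addKr.
  pose A := f%:M - E3 *m t1 - s1 *m E2.
  have AE3 : A *m E3 = 0.
    rewrite /A !mulmxBl -(mulmxA s1) -(mulmxA E3) E2E3 mulmx0 subr0 t1E mulmxBr.
    by rewrite mul_scalar_mx mul_mx_scalar mulmxA E3E4 mul0mx subr0 subrr.
  have Au : A *m u = 0.
    have [a ea] := generic_ker_E2 E2u.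
    have AuF : (A *m u)^F = 0 by rewrite map_mxM ea mulmxA -map_mxM AE3 map_mx0 mul0mx.
    apply/matrixP=> i j; have /matrixP/(_ i j) := AuF.
    by rewrite mxE [RHS]mxE => /eqP; rewrite tofrac_eq0 => /eqP ->; rewrite mxE.
  exists (t1 *m u); apply/eqP; rewrite -subr_eq0 -Au /A !mulmxBl mul_scalar_mx.
  by rewrite -(mulmxA s1) -(mulmxA E3) E2u mulmx0 subr0.
case=> [a ea] [b eb] [c ec].
(* Lifts through E3 of two multiples of f u differ, after cross multiplication, by an element of the
   kernel of E3, hence by a multiple of E4. *)
have aux (p q : P) (v w : 'cV_n.+1) : (p * f) *: u = E3 *m v ->
    (q * f) *: u = E3 *m w -> exists d, q *: v - p *: w = E4 *m d.
  move=> ev ew; apply: ker_E3; rewrite mulmxBr -!scalemxAr -ev -ew !scalerA.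
  by rewrite (mulrCA q) subrr.
have [dab eab] := aux _ _ _ _ ea eb.
have [dac eac] := aux _ _ _ _ ea ec.
have [dbc ebc] := aux _ _ _ _ eb ec.
(* This cocycle relation and the regularity of z put [dab] in the ideal (x, y). Multiples of E4 then
   correct [a] and [b] until x divides [a], and the quotient lifts f u. *)
have: z *: dab = y *: dac - x *: dbc.
  apply: E4_inj; rewrite mulmxBr -!scalemxAr -eab -eac -ebc !scalerBr !scalerA.
  by rewrite (mulrC y x) (mulrC z x) (mulrC y z) opprB addrA addrNK.
move/matrixP/(_ 0 0); rewrite !mxE => eq.
have [|g [h eg]] := @regz (dab 0 0) (- dbc 0 0) (dac 0 0).
  by rewrite eq; ring.
have {}eab : y *: (a - E4 *m h%:M) = x *: (b + E4 *m g%:M).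
  have {}eg : dab = x *: g%:M + y *: h%:M.
    by apply/matrixP=> i j; rewrite !mxE !ord1 eg eqxx !mulr1n.
  rewrite scalerBr scalerDr -[y *: a](subrK (x *: b)) eab eg mulmxDr -!scalemxAr.
  by rewrite addrAC addrK addrC.
have [d ed] : exists d, a - E4 *m h%:M = x *: d.
  have H i : exists q, (a - E4 *m h%:M) i 0 = x * q.
    apply: (regy (g := (b + E4 *m g%:M) i 0)).
    by have /matrixP/(_ i 0) := eab; rewrite mxE => ->; rewrite mxE.
  have [q qE] := fin_all_exists H.
  by exists (\col_i q i); apply/matrixP=> i j; rewrite ord1 qE !mxE.
exists d; apply: (scale_mx_inj x0); rewrite scalerA ea scalemxAr -ed mulmxBr.
by rewrite mulmxA E3E4 mul0mx subr0.
Qed.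

End SelfDual.

(** * Linear forms *)

Lemma pihomog_homogM (R : nzRingType) n (f g : {mpoly R[n]}) b d :
  f \is b.-homog -> pihomog mdeg (b + d) (f * g) = f * pihomog mdeg d g.
Proof.
move=> hf; rewrite {1}(pihomog_partitionE (leqnn (mmeasure mdeg g))) mulr_sumr linear_sum /=.
rewrite [in RHS](pihomog_partitionE (leqnn (mmeasure mdeg g))) linear_sum mulr_sumr.
apply: eq_bigr => e _ /=; have he := pihomogP mdeg e g.
have hfe := dhomogM hf he.
have [<-|ne] := eqVneq (val e) d; first by rewrite (pihomog_dE hfe) (pihomog_dE he).
rewrite (pihomog_ne0 _ hfe) ?(pihomog_ne0 _ he) ?mulr0 //.
by rewrite eqn_add2l.
Qed.

Lemma pihomog_homogM0 (R : nzRingType) n (f g : {mpoly R[n]}) b d :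
  (d < b)%N -> f \is b.-homog -> pihomog mdeg d (f * g) = 0.
Proof.
move=> lt_db hf; rewrite (pihomog_partitionE (leqnn (mmeasure mdeg g))) mulr_sumr linear_sum /=.
apply: big1 => e _ /=; apply: pihomog_ne0 (dhomogM hf (pihomogP _ _ _)).
by rewrite gtn_eqF // ltn_addr.
Qed.

Section LinearForms.

Variables (k : fieldType) (U : vectType k).
Local Notation P := {mpoly k[\dim {:U}]}.

Lemma inSym_is_linear : linear (@inSym k U).
Proof.
move=> c u v; rewrite /inSym scaler_sumr -big_split; apply: eq_bigr => i _.
by rewrite /= linearP scalerDl scalerA.
Qed.

HB.instance Definition _ :=
  GRing.isLinear.Build k U P _ (@inSym k U) inSym_is_linear.

Lemma inSym0 : inSym 0 = 0 :> P. Proof. exact: raddf0. Qed.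

Lemma inSym_vbasis (i : 'I_(\dim {:U})) : inSym (vbasis {:U})`_i = 'X_i :> P.
Proof.
rewrite /inSym (bigD1 i) //= coord_free ?(basis_free (vbasisP _)) // eqxx scale1r.
rewrite big1 ?addr0 // => j ji.
by rewrite coord_free ?(basis_free (vbasisP _)) // eq_sym (negPf ji) scale0r.
Qed.

Lemma inSym_homog (u : U) : inSym u \is 1.-homog.
Proof.
apply: rpred_sum => i _; apply: rpredZ.
by rewrite dhomogX /= mdeg1.
Qed.

Lemma inSym_surj (f : P) : f \is 1.-homog -> exists u : U, f = inSym u.
Proof.
move=> hf; exists (\sum_i f@_U_(i) *: (vbasis {:U})`_i).
rewrite linear_sum /=; apply/mpolyP=> m; rewrite linear_sum /=.
have [/mdeg1P[i /eqP ->]|] := boolP (mdeg m == 1%N).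
  rewrite (bigD1 i) //= linearZ /= inSym_vbasis mcoeffZ mcoeffX eqxx mulr1.
  rewrite big1 ?addr0 // => j ji.
  by rewrite linearZ /= inSym_vbasis mcoeffZ mcoeffX eq_mnm1 (negPf ji) mulr0.
move=> dm; rewrite (dhomog_nemf_coeff hf dm) big1 // => j _.
rewrite linearZ /= inSym_vbasis mcoeffZ mcoeffX; case: eqP => [e|]; rewrite ?mulr0 //.
by rewrite -e mdeg1 in dm.
Qed.

Lemma inSym_inj : injective (@inSym k U).
Proof.
move=> u v e; rewrite (coord_vbasis (memvf u)) (coord_vbasis (memvf v)).
apply: eq_bigr => i _; congr (_ *: _).
have H (t : U) : (inSym t)@_U_(i) = coord (vbasis {:U}) i t.
  rewrite /inSym linear_sum (bigD1 i) //= mcoeffZ mcoeffX eqxx mulr1.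
  rewrite big1 ?addr0 // => j ji.
  by rewrite mcoeffZ mcoeffX eq_mnm1 (negPf ji) mulr0.
by rewrite -!H e.
Qed.

Variables (n : nat) (e : n.-tuple U).
Hypothesis e_basis : basis_of {:U} e.

Section Substitution.

Variable pi : {linear U -> U}.
(** The algebra endomorphism Sym(pi) of P. *)
Definition subst_inSym (f : P) : P :=
  mmap (@mpolyC _ _) (fun i => inSym (pi (vbasis {:U})`_i)) f.

HB.instance Definition _ := GRing.RMorphism.copy subst_inSym
  (mmap (@mpolyC _ _) (fun i => inSym (pi (vbasis {:U})`_i))).

Lemma subst_inSymC c : subst_inSym c%:MP = c%:MP.
Proof. exact: mmapC. Qed.

Lemma subst_inSymE u : subst_inSym (inSym u) = inSym (pi u).
Proof.
rewrite (coord_vbasis (memvf u)) !linear_sum raddf_sum.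
apply: eq_bigr => i _; rewrite !linearZ /= inSym_vbasis -mul_mpolyC rmorphM /=.
by rewrite subst_inSymC {1}/subst_inSym mmapX mmap1U mul_mpolyC.
Qed.

Variable r : nat.
Hypothesis pi_diff : forall u, exists c : 'I_n -> k,
  u - pi u = \sum_(i < n | (i < r)%N) c i *: e`_i.

(** The property holds for constants and variables and is stable under sums and products, because pq
    - p'q' = (p - p')q + p'(q - q'). *)
Lemma subst_inSym_diff f : exists g : 'I_n -> P,
  f - subst_inSym f = \sum_(i < n | (i < r)%N) inSym e`_i * g i.
Proof.
pose D f := exists g : 'I_n -> P,
  f - subst_inSym f = \sum_(i < n | (i < r)%N) inSym e`_i * g i.
have DD p q : D p -> D q -> D (p + q).
  move=> [g eg] [h eh]; exists (fun i => g i + h i).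
  rewrite rmorphD opprD addrACA eg eh -big_split.
  by apply: eq_bigr => i _; rewrite mulrDr.
have DM p q : D p -> D q -> D (p * q).
  move=> [g eg] [h eh]; exists (fun i => g i * q + subst_inSym p * h i).
  have -> : p * q - subst_inSym (p * q) =
    (p - subst_inSym p) * q + subst_inSym p * (q - subst_inSym q).
    by rewrite rmorphM; ring.
  rewrite eg eh mulr_suml mulr_sumr -big_split; apply: eq_bigr => i _ /=; ring.
have DC c : D c%:MP.
  exists (fun=> 0); rewrite subst_inSymC subrr big1 // => i _; exact: mulr0.
have DX i : D 'X_i.
  have [c ec] := pi_diff (vbasis {:U})`_i; exists (fun i => (c i)%:MP).
  rewrite -inSym_vbasis subst_inSymE -linearB ec linear_sum.
  by apply: eq_bigr => j _; rewrite linearZ /= mulrC mul_mpolyC.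
elim/mpolyind: f => [|c m p _ _]; first exact: (DC 0).
apply: (DD); rewrite -mul_mpolyC; apply: (DM) => //.
rewrite mpolyXE_id; apply: (big_ind D) => [|p1 p2|i _]; [exact: (DC 1)|exact: (DM)|].
elim: (m i) => [|l IH]; first exact: (DC 1).
by rewrite exprS; apply: DM.
Qed.

End Substitution.

(** Through [subst_inSym] this realises the quotient of P by the first r basis vectors as an
    endomorphism of P. *)
Definition basis_proj r (u : U) := \sum_(i < n | (r <= i)%N) coord e i u *: e`_i.

Lemma basis_proj_linear r : linear (basis_proj r).
Proof.
move=> c u v; rewrite /basis_proj scaler_sumr -big_split; apply: eq_bigr => i _ /=.
by rewrite linearP scalerDl scalerA.
Qed.

HB.instance Definition _ r :=
  GRing.isLinear.Build k U U _ (basis_proj r) (basis_proj_linear r).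

Lemma basis_proj_diff r u : exists c : 'I_n -> k,
  u - basis_proj r u = \sum_(i < n | (i < r)%N) c i *: e`_i.
Proof.
exists (coord e ^~ u); rewrite {1}(coord_basis e_basis (memvf u)).
rewrite (bigID (fun i : 'I_n => (r <= i)%N)) /= /basis_proj addrAC subrr add0r.
by apply: eq_bigl => i; rewrite ltnNge.
Qed.

Lemma basis_proj_basis r (i : 'I_n) : basis_proj r e`_i = if (r <= i)%N then e`_i else 0.
Proof.
rewrite /basis_proj big_mkcond (bigD1 i) //= coord_free ?(basis_free e_basis) // eqxx scale1r.
rewrite big1 ?addr0 // => j ji.
by rewrite coord_free ?(basis_free e_basis) // eq_sym (negPf ji) scale0r if_same.
Qed.

(** The endomorphism that kills the first r basis vectors fixes the next one and kills the
    right-hand side. As P is a domain, it kills f too, so f equals its difference from its image,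
    which lies in the ideal. *)
Lemma basis_regular (r : 'I_n) (f : P) (g : 'I_n -> P) :
  inSym e`_r * f = \sum_(i < n | (i < r)%N) inSym e`_i * g i ->
  exists h : 'I_n -> P, f = \sum_(i < n | (i < r)%N) inSym e`_i * h i.
Proof.
move=> /(congr1 (subst_inSym (basis_proj r))).
rewrite rmorphM /= subst_inSymE /= basis_proj_basis leqnn [RHS]raddf_sum /=.
rewrite big1 => [|i ir]; last first.
  by rewrite rmorphM /= subst_inSymE /= basis_proj_basis leqNgt ir inSym0 mul0r.
move/eqP; rewrite mulf_eq0 => /orP[/eqP|/eqP s0].
  rewrite -inSym0 => /inSym_inj e0.
  have er : e`_r \in (e : seq U) by rewrite mem_nth ?size_tuple.
  by have := free_not0 (basis_free e_basis) er; rewrite e0 eqxx.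
have [h eh] := subst_inSym_diff (basis_proj_diff r) f.
by exists h; rewrite -eh s0 subr0.
Qed.

(** With r = n the projection is zero, so the image of f under the induced endomorphism is a
    constant. *)
Lemma basis_decomposition (f : P) :
  exists c (g : 'I_n -> P), f = c%:MP + \sum_(i < n) inSym e`_i * g i.
Proof.
have [g eg] := subst_inSym_diff (basis_proj_diff n) f.
have pi0 u : basis_proj n u = 0.
  by rewrite /basis_proj big1 // => i; rewrite leqNgt ltn_ord.
have [c ec] : exists c, subst_inSym (basis_proj n) f = c%:MP.
  rewrite /subst_inSym; elim/mpolyind: f {g eg} => [|c m p _ _ [c' IH]].
    by exists 0; rewrite mmap0 mpolyC0.
  rewrite mmapD IH mmapZ mmapX /mmap1.
  have [c'' ->] : exists c'' : k,
     \prod_(i < \dim {:U}) inSym (basis_proj n (vbasis {:U})`_i) ^+ m i = c''%:MP :> P.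
    apply: (big_ind (fun p : P => exists c, p = c%:MP)) => [|p1 p2 [c1 ->] [c2 ->]|i _].
    - by exists 1.
    - by exists (c1 * c2); rewrite mpolyCM.
    - by rewrite pi0 inSym0 expr0n; case: (_ == _); [exists 1|exists 0]; rewrite ?mpolyC0.
  by exists (c * c'' + c'); rewrite mpolyCD mpolyCM.
exists c, g; rewrite -ec addrC; apply/eqP; rewrite -subr_eq eg; apply/eqP.
by apply: eq_bigl => i; rewrite ltn_ord.
Qed.

End LinearForms.

Lemma homog_mpolyC (k : fieldType) n (c : k) : (c%:MP : {mpoly k[n]}) \is 0.-homog.
Proof. by rewrite -[c%:MP]mulr1 mul_mpolyC; apply/dhomogZ/dhomog1. Qed.

Lemma homogM (k : fieldType) n d d' (p q : {mpoly k[n]}) :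
  p \is d.-homog -> q \is d'.-homog -> p * q \is (d + d').-homog.
Proof. exact: dhomogM. Qed.

Lemma homog_coeff0 (k : fieldType) n d (p : {mpoly k[n]}) :
  p \is d.-homog -> (0 < d)%N -> p@_0%MM = 0.
Proof. by move=> h d0; apply: (dhomog_nemf_coeff h); rewrite mf0 eq_sym -lt0n. Qed.

(** * Graded Nakayama lemma *)

Section GradedNakayama.

Variables (k : fieldType) (N n p : nat).
Local Notation P := {mpoly k[N]}.
Variables (b : 'I_n -> nat) (c : 'I_p -> nat) (M : 'M[P]_(n, p)) (x : P).
Hypotheses (M_homog : homogeneous_mx b c M) (x_homog : x \is 1.-homog).

(** The degree-d component in the sum of the P(-a i); the test guards the truncated subtraction. *)
Definition homog_part r (a : 'I_r -> nat) d (v : 'cV[P]_r) : 'cV[P]_r :=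
  \col_i (if (a i <= d)%N then pihomog mdeg (d - a i) (v i 0) else 0).

Lemma homog_partD r (a : 'I_r -> nat) d v v' :
  homog_part a d (v + v') = homog_part a d v + homog_part a d v'.
Proof. by apply/colP=> i; rewrite !mxE; case: ifP => _; rewrite ?linearD ?addr0. Qed.

Lemma homog_part_mul d t : homog_part b d (M *m t) = M *m homog_part c d t.
Proof.
apply/colP=> i; rewrite !mxE; case: leqP => [le_bd|lt_db].
  rewrite linear_sum; apply: eq_bigr => j _ /=; rewrite mxE.
  have [->|[le_bc hM]] := M_homog i j; first by rewrite !mul0r linear0.
  case: leqP => [le_cd|lt_dc].
    have -> : (d - b i = (c j - b i) + (d - c j))%N by rewrite addnC addnBA // subnK.
    exact: pihomog_homogM.
  by rewrite mulr0 (pihomog_homogM0 _ _ hM) // ltn_sub2r // (leq_ltn_trans le_bd).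
symmetry; apply: big1 => j _; rewrite mxE.
have [->|[le_bc _]] := M_homog i j; first by rewrite mul0r.
by rewrite leqNgt (leq_trans lt_db le_bc) mulr0.
Qed.

Lemma homog_part_scaleS d v : homog_part b d.+1 (x *: v) = x *: homog_part b d v.
Proof.
apply/colP=> i; rewrite !mxE; case: (leqP (b i) d) => [le_bd|lt_db].
  by rewrite leqW // subSn // -add1n pihomog_homogM.
rewrite mulr0; case: ifP => // le_b.
by rewrite (_ : (d.+1 - b i = 0)%N) ?(pihomog_homogM0 _ _ x_homog) //; apply/eqP.
Qed.

Lemma homog_part_scale0 v : homog_part b 0 (x *: v) = 0.
Proof.
apply/colP=> i; rewrite !mxE; case: ifP => // _.
by rewrite sub0n (pihomog_homogM0 _ _ x_homog).
Qed.

Lemma homog_part_sum v : exists K, v = \sum_(d < K) homog_part b d v.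
Proof.
(* A common strict bound for the degrees of all the coordinates, shifts included. *)
exists (\sum_i (b i + msize (v i ord0)))%N; apply/colP=> i; rewrite summxE.
have le_K : (b i + msize (v i ord0) <= \sum_i (b i + msize (v i ord0)))%N.
  by rewrite [leqRHS](bigD1 i) //= leq_addr.
rewrite -(subnKC (leq_trans (leq_addr _ _) le_K)) big_split_ord /= big1 ?add0r; last first.
  by move=> d _; rewrite mxE leqNgt ltn_ord.
rewrite [LHS](pihomog_partitionE (mf := mdeg) (k := \sum_i (b i + msize (v i ord0)) - b i)).
  by apply: eq_bigr => d _; rewrite mxE leq_addr addKn.
by rewrite leq_subRL // (leq_trans (leq_addr _ _) le_K).
Qed.

Variable K : 'cV[P]_n -> Prop.
Hypothesis step : forall v, K v -> exists t v', v = M *m t + x *: v' /\ K v'.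

(** By induction on d, the degree-d component of any element of [K] is in the image of [M]: the
    component of x v' is x times the component of v' one degree lower, and it is zero in degree
    0. *)
Lemma graded_nakayama v : K v -> exists t, v = M *m t.
Proof.
move=> Kv.
have H d : forall u, K u -> exists t, homog_part b d u = M *m t.
  elim: d => [|d IH] u /step[t [u' [-> /[dup] Ku' _]]]; rewrite homog_partD homog_part_mul.
    by rewrite homog_part_scale0 addr0; eexists.
  have [t' et'] := IH u' Ku'; rewrite homog_part_scaleS et' scalemxAr -mulmxDr.
  by eexists.
have [m ->] := homog_part_sum v.
have [t et] := fin_all_exists (fun d : 'I_m => H d v Kv).
exists (\sum_d t d); rewrite mulmx_sumr; apply: eq_bigr => d _; exact: et.
Qed.

End GradedNakayama.

(** * Deleting rows and columns *)

Lemma sum_codom (V : nmodType) n n' (f : 'I_n' -> 'I_n) (F : 'I_n -> V) :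
  injective f -> (forall i, i \notin codom f -> F i = 0) ->
  \sum_i F i = \sum_i F (f i).
Proof.
move=> f_inj F0; rewrite [RHS](partition_big f xpredT) //=; apply: eq_bigr => i _.
have [/codomP[j ->]|ni] := boolP (i \in codom f).
  rewrite (big_pred1 j) // => j'; exact: inj_eq.
by rewrite F0 // big_pred0 // => j; apply: contraNF ni => /eqP <-; apply: codom_f.
Qed.

Section Submatrix.

Variables (k : fieldType) (N n n' m m' : nat).
Local Notation P := {mpoly k[N]}.
Variables (r : 'I_n' -> 'I_n) (c : 'I_m' -> 'I_m).
Variables (M1 : 'M[P]_(1, n)) (M2 : 'M[P]_(n, m)).
Hypotheses (r_inj : injective r) (c_inj : injective c).
Hypothesis M1_supp : forall i, i \notin codom r -> M1 0 i = 0.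
Hypothesis M2_supp : forall i j, j \notin codom c -> M2 (r i) j = 0.

Lemma colsub_mul q (u : 'M[P]_(n, q)) : M1 *m u = colsub r M1 *m rowsub r u.
Proof.
apply/matrixP=> a j; rewrite !mxE ord1 (sum_codom r_inj) => [|i ni].
  by apply: eq_bigr => i _; rewrite !mxE.
by rewrite M1_supp ?mul0r.
Qed.

Lemma mxsub_mul q (t : 'M[P]_(m, q)) : rowsub r (M2 *m t) = mxsub r c M2 *m rowsub c t.
Proof.
apply/matrixP=> i j; rewrite !mxE (sum_codom c_inj) => [|l nl].
  by apply: eq_bigr => l _; rewrite !mxE.
by rewrite M2_supp ?mul0r.
Qed.

Lemma rowsub_surj p q (f : 'I_p -> 'I_q) (u : 'cV[P]_p) :
  injective f -> exists u', rowsub f u' = u.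
Proof.
move=> f_inj; exists (\col_i \sum_(j | f j == i) u j 0); apply/colP=> i; rewrite !mxE.
by rewrite (big_pred1 i) // => j; apply: inj_eq.
Qed.

Lemma colsub_image f : (exists u : 'cV[P]_n, f%:M = M1 *m u) <->
  (exists u : 'cV[P]_n', f%:M = colsub r M1 *m u).
Proof.
split=> [[u ->]|[u ->]]; first by exists (rowsub r u); rewrite colsub_mul.
by have [u' <-] := rowsub_surj u r_inj; exists u'; rewrite colsub_mul.
Qed.

(** [M1] sees only the kept coordinates, and the kept rows of [M2] see only the kept columns; so
    vectors restrict and extend freely between the two complexes. *)
Lemma exact_submx : exact_at M1 M2 -> exact_at (colsub r M1) (mxsub r c M2).
Proof.
move=> ex v; have [u <-] := rowsub_surj v r_inj; rewrite -colsub_mul.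
split=> [/ex[t ->]|[t et]]; first by exists (rowsub c t); rewrite mxsub_mul.
have [t' et'] := rowsub_surj t c_inj.
rewrite colsub_mul et -et' -mxsub_mul -colsub_mul.
by apply/ex; exists t'.
Qed.

End Submatrix.

Lemma exact_at_units (k : fieldType) N p n m (M1 : 'M[{mpoly k[N]}]_(p, n))
    (M2 : 'M[{mpoly k[N]}]_(n, m)) S T : S \in unitmx -> T \in unitmx ->
  exact_at M1 M2 -> exact_at (M1 *m S) (invmx S *m M2 *m T).
Proof.
move=> uS uT ex v; rewrite -mulmxA; split=> [/ex[t et]|[t ->]].
  by exists (invmx T *m t); rewrite -!mulmxA (mulmxA T) mulmxV // mul1mx -et mulKmx.
by apply/ex; exists (T *m t); rewrite -!mulmxA mulKVmx.
Qed.

(** The index permutation of the hyperbolic form, so that multiplying by its matrix becomes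
    reindexing. *)
Definition swap_halves n (i : 'I_(n + n)) : 'I_(n + n) :=
  match split i with inl j => rshift n j | inr j => lshift n j end.

Lemma swap_halves_mul (R : pzRingType) n q (M : 'M[R]_(n + n, q)) i j :
  (block_mx 0 1%:M 1%:M 0 *m M) i j = M (swap_halves i) j.
Proof.
rewrite -[M]vsubmxK mul_block_col !mul0mx !mul1mx add0r addr0 /swap_halves.
by case: (split_ordP i) => l ->; rewrite ?(col_mxEu, col_mxEd).
Qed.

(** The only block of the product that could differ is the lower right one, and it equals M +
    M^T. *)
Lemma unipotent_isometry (R : comPzRingType) n (M : 'M[R]_n) : M^T = - M ->
  block_mx 1%:M 0 M 1%:M *m block_mx 0 1%:M 1%:M 0 *m (block_mx 1%:M 0 M 1%:M)^T
  = block_mx 0 1%:M 1%:M 0.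
Proof.
move=> skew; rewrite tr_block_mx skew !trmx1 trmx0 !mulmx_block.
by rewrite !(mul1mx, mulmx1, mul0mx, mulmx0, add0r, addr0) addNr.
Qed.

Lemma unipotent_unit (R : comUnitRingType) n (M : 'M[R]_n) : block_mx 1%:M 0 M 1%:M \in unitmx.
Proof. by rewrite unitmxE det_lblock !det1 mul1r unitr1. Qed.

Lemma keep7E i : keep7 i = nth 0 [:: 0; 3; 4; 5; 6; 7; 8]%N i :> nat.
Proof. by rewrite inordK //; case: i => [[|[|[|[|[|[|[|?]]]]]]]]. Qed.

Lemma keep12E j : keep12 j = nth 0 [:: 0; 3; 4; 5; 6; 7; 8; 11; 12; 13; 14; 15]%N j :> nat.
Proof. by rewrite inordK //; case: j => [[|[|[|[|[|[|[|[|[|[|[|[|?]]]]]]]]]]]]]. Qed.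

Lemma keep7_inj : injective keep7.
Proof.
move=> i j /(congr1 val) /=; rewrite !keep7E => /eqP.
by rewrite nth_uniq // => /eqP /val_inj.
Qed.

Lemma keep12_inj : injective keep12.
Proof.
move=> i j /(congr1 val) /=; rewrite !keep12E => /eqP.
by rewrite nth_uniq // => /eqP /val_inj.
Qed.

Lemma keep7_codom i : i \notin codom keep7 -> nat_of_ord i \in [:: 1; 2]%N.
Proof.
apply: contraR => ni; apply/codomP.
exists (inord (index (i : nat) [:: 0; 3; 4; 5; 6; 7; 8]%N)); apply: val_inj.
rewrite /= keep7E inordK.
  by case: i ni => [[|[|[|[|[|[|[|[|[|?]]]]]]]]]].
by case: i ni => [[|[|[|[|[|[|[|[|[|?]]]]]]]]]].
Qed.

Lemma keep12_codom j : j \notin codom keep12 -> nat_of_ord j \in [:: 1; 2; 9; 10]%N.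
Proof.
apply: contraR => nj; apply/codomP.
exists (inord (index (j : nat) [:: 0; 3; 4; 5; 6; 7; 8; 11; 12; 13; 14; 15]%N)).
apply: val_inj; rewrite /= keep12E inordK.
  by case: j nj => [[|[|[|[|[|[|[|[|[|[|[|[|[|[|[|[|?]]]]]]]]]]]]]]]]].
by case: j nj => [[|[|[|[|[|[|[|[|[|[|[|[|[|[|[|[|?]]]]]]]]]]]]]]]]].
Qed.

Lemma swap_halvesE n (i : 'I_(n + n)) :
  swap_halves i = (if i < n then n + i else i - n)%N :> nat.
Proof.
rewrite /swap_halves; case: (split_ordP i) => j -> //=.
by rewrite addKn.
Qed.

(** The kept columns come in hyperbolic pairs, so [mxJ] is the restriction of the form on P^16. *)
Lemma keep12_swap j : keep12 (swap_halves j) = swap_halves (keep12 j).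
Proof.
apply: val_inj; rewrite /= keep12E !swap_halvesE keep12E.
by case: j => [[|[|[|[|[|[|[|[|[|[|[|[|?]]]]]]]]]]]]].
Qed.

(** * The product on U *)

Lemma linfunE (k : fieldType) (U V : vectType k) (f : U -> V) :
  linear f -> linfun f =1 f.
Proof.
move=> lin_f u.
pose g : {linear U -> V} := HB.pack f (GRing.isLinear.Build _ _ _ _ f lin_f).
exact: (lfunE g).
Qed.

(* Multiplication by x identifies the degrees 1 and 2 of P / ann Phi, so the
   product of the algebra induces a commutative product on U with unit x. *)
HB.lock Definition umul (k : fieldType) (U : vectType k)
  (Phi : {linear {mpoly k[\dim {:U}]} -> k^o}) (x a b : U) : U :=
  pinv Phi x (to_dual Phi (inSym a * inSym b)).

Section Algebra.

Variables (k : fieldType) (U : vectType k).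
Local Notation P := {mpoly k[\dim {:U}]}.
Variables (Phi : {linear P -> k^o}) (x : U).
Local Notation X := (inSym x).
Local Notation dualU := 'Hom(U, k^o).

Lemma to_dualE (f : P) v : to_dual Phi f v = Phi (f * inSym v).
Proof.
rewrite /to_dual linfunE // => c u u'.
by rewrite /contract linearP mulrDr -scalerAr linearP.
Qed.

Lemma to_dual_is_linear : linear (to_dual Phi).
Proof.
move=> c f g; apply/lfunP=> v.
by rewrite add_lfunE scale_lfunE !to_dualE mulrDl -scalerAl linearP.
Qed.

HB.instance Definition _ :=
  GRing.isLinear.Build k P dualU _ (to_dual Phi) to_dual_is_linear.

Lemma p_mapE u v : p_map Phi x u v = Phi (inSym u * X * inSym v).
Proof.
rewrite /p_map linfunE ?to_dualE // => c a b.
by rewrite linearP mulrDl -scalerAl linearP.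
Qed.

Hypothesis Phi_deg : in_D 3 Phi.

Lemma Phi_pihomog f : Phi f = Phi (pihomog mdeg 3 f).
Proof.
set g := pihomog _ _ _.
have gE d : pihomog mdeg d (f - g) = if d == 3 then 0 else pihomog mdeg d f.
  rewrite linearB /=; case: eqP => [->|/eqP d3]; first by rewrite pihomog_id subrr.
  by rewrite (pihomog_ne0 _ (pihomogP mdeg 3 f)) ?subr0 // eq_sym.
rewrite -[f](subrK g) linearD /= (pihomog_partitionE (leqnn (mmeasure mdeg (f - g)))).
rewrite linear_sum big1 ?add0r // => d _; rewrite gE.
by case: eqP => [_|/eqP d3]; [exact: linear0|apply: Phi_deg (pihomogP _ _ _)].
Qed.

Lemma annP_homog d e f : (d + e = 3)%N -> f \is d.-homog ->
  (forall g, g \is e.-homog -> Phi (f * g) = 0) -> ann Phi f.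
Proof.
move=> de hf H g; rewrite /contract Phi_pihomog -de pihomog_homogM //.
by apply: H; apply: pihomogP.
Qed.

Lemma ann_homog_gt d f : (3 < d)%N -> f \is d.-homog -> ann Phi f.
Proof. by move=> d3 hf g; rewrite /contract Phi_pihomog (pihomog_homogM0 _ d3 hf) linear0. Qed.

Hypothesis no_linear : forall u : U, u != 0 -> ~ ann Phi (inSym u).
Hypothesis wl : weak_Lefschetz Phi x.

(** Let t be in the kernel, so that [Phi] vanishes on t x U. If x is injective from degree 1, then t
    x, hence t, annihilates [Phi]. If x is onto degree 2, then [Phi] vanishes on t times every
    quadric. Either way t = 0, as no nonzero linear form annihilates [Phi]. *)
Lemma p_map_inj : lker (p_map Phi x) == 0%VS.
Proof.
apply/lker0P=> u v /eqP; rewrite -subr_eq0 -linearB => /eqP e.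
apply/eqP; rewrite -subr_eq0; set t := u - v in e *.
have {}e c : Phi (inSym t * X * inSym c) = 0 by rewrite -p_mapE e zero_lfunE.
apply/negPn/negP=> /no_linear; apply.
have [inj|surj] := wl 1%N.
  apply: inj; first exact: inSym_homog.
  apply: (@annP_homog 2 1) => // [|g /inSym_surj[c ->]].
    exact: dhomogM (inSym_homog _) (inSym_homog _).
  by rewrite (mulrC X) e.
apply: (@annP_homog 1 2) => [||g hg] //; first exact: inSym_homog.
have [f /inSym_surj[c ->] he] := surj g hg.
rewrite -[g](subrK (X * inSym c)) mulrDr linearD /= [_ * (X * _)]mulrA e addr0 mulrC.
exact: he.
Qed.

Lemma p_mapK : cancel (p_map Phi x) (pinv Phi x).
Proof. exact: (lker0_lfunK p_map_inj). Qed.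

Lemma pinvK : cancel (pinv Phi x) (p_map Phi x).
Proof.
move=> nu; apply: limg_lfunVK.
suff -> : limg (p_map Phi x) = fullv by rewrite memvf.
apply/eqP; rewrite eqEdim subvf limg_dim_eq ?(eqP p_map_inj) ?capv0 //.
by rewrite !dimvf /dim /= /dim /= muln1.
Qed.

Lemma pinv_is_linear : linear (pinv Phi x).
Proof. by move=> c u v; rewrite /pinv linearP. Qed.

HB.instance Definition _ :=
  GRing.isLinear.Build k dualU U _ (pinv Phi x) pinv_is_linear.

Lemma Phi_pinv nu u : Phi (inSym (pinv Phi x nu) * X * inSym u) = nu u.
Proof. by rewrite -p_mapE pinvK. Qed.

Lemma p_form_inj u v :
  (forall t, Phi (inSym u * X * inSym t) = Phi (inSym v * X * inSym t)) -> u = v.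
Proof.
move=> e; apply: (can_inj p_mapK); apply/lfunP=> t; rewrite !p_mapE; exact: e.
Qed.

Lemma Phi_umul a b c :
  Phi (inSym (umul Phi x a b) * X * inSym c) = Phi (inSym a * inSym b * inSym c).
Proof. by rewrite umul.unlock Phi_pinv to_dualE. Qed.

Local Notation umul := (umul Phi x).

Lemma umulC a b : umul a b = umul b a.
Proof. by rewrite umul.unlock mulrC. Qed.

Lemma umulxl a : umul x a = a.
Proof. by apply: p_form_inj => t; rewrite Phi_umul (mulrC X). Qed.

Lemma umulxr a : umul a x = a.
Proof. by rewrite umulC umulxl. Qed.

Lemma umul_is_linear a : linear (umul a).
Proof. by move=> c u v; rewrite umul.unlock linearP mulrDr -scalerAr !linearP. Qed.

HB.instance Definition _ a :=
  GRing.isLinear.Build k U U _ (umul a) (umul_is_linear a).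

End Algebra.

(** * Coordinates on U and on the symmetric square of U_0 *)

HB.lock Definition dual_form (k : fieldType) (U : vectType k) (x y z w : U) (i : nat) :
    'Hom(U, k^o) :=
  yzw_dual x y z w (inord i).

Section Coordinates.

Variables (k : fieldType) (U : vectType k) (xs : 'Hom(U, k^o)) (x y z w : U).
Hypothesis dimU : \dim {:U} = 4%N.
Hypothesis xs_x : xs x = 1.
Hypothesis yzw_basis : basis_of (lker xs) [:: y; z; w].

Lemma xyzw_basis : basis_of {:U} [tuple x; y; z; w].
Proof.
rewrite basisEfree subvf dimU /= andbT free_cons (basis_free yzw_basis) andbT.
rewrite (span_basis yzw_basis) memv_ker xs_x; exact: oner_neq0.
Qed.

Let xyzw_free := basis_free xyzw_basis.
Local Notation ys := (dual_form x y z w 0).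
Local Notation zs := (dual_form x y z w 1).
Local Notation ws := (dual_form x y z w 2).

Lemma yzw_dualE i u : yzw_dual x y z w i u = coord [tuple x; y; z; w] (lift ord0 i) u.
Proof.
by rewrite /yzw_dual linfunE // => c a b; rewrite linearP.
Qed.

Lemma yzw_dual_basis i j :
  yzw_dual x y z w i (nth 0 [:: x; y; z; w] j) = (j == i.+1)%:R.
Proof.
case: (ltnP j 4) => [lt_j|ge_j]; last first.
  rewrite nth_default // linear0; case: eqP => // e.
  by have := ltn_ord i; rewrite -ltnS -e ltnNge ge_j.
by rewrite yzw_dualE (coord_free (Ordinal lt_j)).
Qed.

Lemma ys_x : ys x = 0. Proof. by rewrite dual_form.unlock (yzw_dual_basis _ 0) inordK. Qed.
Lemma zs_x : zs x = 0. Proof. by rewrite dual_form.unlock (yzw_dual_basis _ 0) inordK. Qed.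
Lemma ws_x : ws x = 0. Proof. by rewrite dual_form.unlock (yzw_dual_basis _ 0) inordK. Qed.
Lemma ys_y : ys y = 1. Proof. by rewrite dual_form.unlock (yzw_dual_basis _ 1) inordK. Qed.
Lemma zs_y : zs y = 0. Proof. by rewrite dual_form.unlock (yzw_dual_basis _ 1) inordK. Qed.
Lemma ws_y : ws y = 0. Proof. by rewrite dual_form.unlock (yzw_dual_basis _ 1) inordK. Qed.
Lemma ys_z : ys z = 0. Proof. by rewrite dual_form.unlock (yzw_dual_basis _ 2) inordK. Qed.
Lemma zs_z : zs z = 1. Proof. by rewrite dual_form.unlock (yzw_dual_basis _ 2) inordK. Qed.
Lemma ws_z : ws z = 0. Proof. by rewrite dual_form.unlock (yzw_dual_basis _ 2) inordK. Qed.
Lemma ys_w : ys w = 0. Proof. by rewrite dual_form.unlock (yzw_dual_basis _ 3) inordK. Qed.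
Lemma zs_w : zs w = 0. Proof. by rewrite dual_form.unlock (yzw_dual_basis _ 3) inordK. Qed.
Lemma ws_w : ws w = 1. Proof. by rewrite dual_form.unlock (yzw_dual_basis _ 3) inordK. Qed.

Lemma xs_yzw u : u \in [:: y; z; w] -> xs u = 0.
Proof. by move/(basis_mem yzw_basis); rewrite memv_ker => /eqP. Qed.
Lemma xs_y : xs y = 0. Proof. by rewrite xs_yzw ?inE ?eqxx ?orbT. Qed.
Lemma xs_z : xs z = 0. Proof. by rewrite xs_yzw ?inE ?eqxx ?orbT. Qed.
Lemma xs_w : xs w = 0. Proof. by rewrite xs_yzw ?inE ?eqxx ?orbT. Qed.

Definition dual_basisE := (xs_x, xs_y, xs_z, xs_w, ys_x, zs_x, ws_x,
  ys_y, zs_y, ws_y, ys_z, zs_z, ws_z, ys_w, zs_w, ws_w).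

Lemma basis_expand u : u = xs u *: x + ys u *: y + zs u *: z + ws u *: w.
Proof.
rewrite dual_form.unlock.
have e := coord_basis xyzw_basis (memvf u).
rewrite !big_ord_recl big_ord0 /= addr0 in e.
rewrite {1}e !addrA.
have ce i (j : 'I_4) : (i < 3)%N -> nat_of_ord j = i.+1 ->
    coord [tuple x; y; z; w] j u = yzw_dual x y z w (inord i) u.
  by move=> lti ji; rewrite yzw_dualE; congr coord; apply: val_inj; rewrite /= inordK.
rewrite (ce 0 (lift ord0 _)) // (ce 1 (lift ord0 (lift ord0 _))) //
  (ce 2 (lift ord0 (lift ord0 (lift ord0 _)))) // in e *.
(* The coordinate along x is [xs], since [xs] is 1 at x and kills y, z, w. *)
suff -> : coord [tuple x; y; z; w] ord0 u = xs u by [].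
have DE := dual_basisE; rewrite dual_form.unlock in DE.
rewrite {2}e !linearD !linearZ /= !DE !scaler0 !addr0; exact/esym/mulr1.
Qed.

Lemma yzwE (i : 'I_3) : yzw y z w i = nth 0 [:: y; z; w] i.
Proof. by rewrite /yzw (tnth_nth 0). Qed.

Lemma yzw_dual_nth (i : 'I_3) : yzw_dual x y z w i = nth 0 [:: ys; zs; ws] i.
Proof.
by rewrite dual_form.unlock; case: i => [[|[|[|?]]]] // H; rewrite /=;
  congr yzw_dual; apply: val_inj; rewrite /= inordK.
Qed.

(** The list of [sym2_index] in plain natural numbers, on which case analysis computes. *)
Definition sym2_exp (r : nat) : nat * nat :=
  nth (0, 0)%N [:: (0, 0); (0, 1); (0, 2); (1, 1); (1, 2); (2, 2)]%N r.

Lemma sym2_indexE r : sym2_index r = (inord (sym2_exp r).1, inord (sym2_exp r).2).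
Proof. by case: r => [[|[|[|[|[|[|?]]]]]]] // H; rewrite /sym2_index (tnth_nth (ord0, ord0)). Qed.

Lemma sym2_coordE a b r :
  sym2_coord x y z w a b r 0 =
  nth 0 [:: ys a * ys b; ys a * zs b + zs a * ys b; ys a * ws b + ws a * ys b;
            zs a * zs b; zs a * ws b + ws a * zs b; ws a * ws b] r.
Proof.
rewrite dual_form.unlock mxE sym2_indexE /= -val_eqE /=.
by case: r => [[|[|[|[|[|[|?]]]]]]] // H; rewrite /= !inordK.
Qed.

End Coordinates.

(* The coefficient at the r-th monomial in the product of the U_0-parts. *)
HB.lock Definition sym2P (k : fieldType) (U : vectType k) (x y z w : U) (r : 'I_6)
    (a b : U) : {mpoly k[\dim {:U}]} :=
  (sym2_coord x y z w a b r 0)%:MP.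

Section Sym2.

Variables (k : fieldType) (U : vectType k) (x y z w : U).
Local Notation P := {mpoly k[\dim {:U}]}.
Local Notation S := (sym2P x y z w).
Local Notation ys := (dual_form x y z w 0).
Local Notation zs := (dual_form x y z w 1).
Local Notation ws := (dual_form x y z w 2).

Lemma SC r a b : S r a b = S r b a.
Proof.
rewrite sym2P.unlock !sym2_coordE.
case: r => [[|[|[|[|[|[|?]]]]]]] // H /=; congr (_%:MP); ring.
Qed.

Lemma S_linear r a : linear (S r a).
Proof.
move=> c u v; rewrite sym2P.unlock !sym2_coordE -mul_mpolyC -mpolyCM -mpolyCD; congr (_%:MP).
have lin (nu : 'Hom(U, k^o)) : nu (c *: u + v) = c * nu u + nu v by rewrite linearP.
by case: r => [[|[|[|[|[|[|?]]]]]]] // H /=; rewrite !lin; ring.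
Qed.
HB.instance Definition _ r a := GRing.isLinear.Build k U P _ (S r a) (S_linear r a).

End Sym2.

(* <ab, cd> *)
HB.lock Definition br (k : fieldType) (U : vectType k)
    (Phi : {linear {mpoly k[\dim {:U}]} -> k^o}) (x a b c d : U) : k :=
  bracket Phi x (inSym a * inSym b) (inSym c * inSym d).

Section Complex.

Variables (k : fieldType) (U : vectType k).
Local Notation P := {mpoly k[\dim {:U}]}.
Local Notation dualU := 'Hom(U, k^o).
Variables (Phi : {linear P -> k^o}) (xs : dualU) (x y z w : U) (alpha : k).
Hypothesis dimU : \dim {:U} = 4%N.
Hypothesis Phi_deg : in_D 3 Phi.
Hypothesis no_linear : forall u : U, u != 0 -> ~ ann Phi (inSym u).
Hypothesis wl : weak_Lefschetz Phi x.
Hypothesis xs_x : xs x = 1.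
Hypothesis yzw_basis : basis_of (lker xs) [:: y; z; w].
Hypothesis SM_eq : SM Phi x y z w
  = \matrix_(i < 3, j < 3) (if (i == ord0) && (j == ord0) then alpha else 0).
Hypothesis alpha_neq0 : alpha != 0.

Local Notation "a ** b" := (umul Phi x a b) (at level 40, left associativity).
Local Notation X := (inSym x).
Local Notation Y := (inSym y).
Local Notation Z := (inSym z).
Local Notation W := (inSym w).
Local Notation ys := (dual_form x y z w 0).
Local Notation zs := (dual_form x y z w 1).
Local Notation ws := (dual_form x y z w 2).
Local Notation pinv := (pinv Phi x).
Local Notation br := (br Phi x).
Local Notation S := (sym2P x y z w).
Local Notation A := (mxA Phi x y z w).
Local Notation B := (mxB Phi x y z w).
Local Notation C := (mxC Phi xs x y z w).
Local Notation D := (mxD Phi xs x y z w).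

Let DE := dual_basisE dimU xs_x yzw_basis.
Let basis_expand := basis_expand dimU xs_x yzw_basis.
Let xyzw_basis := xyzw_basis dimU xs_x yzw_basis.
Let yzwE := yzwE y z w.
Let Phi_umul := Phi_umul Phi_deg no_linear wl.
Let umulxr := umulxr Phi_deg no_linear wl.

(** * The invariant form and the commutation relations encoded by SM *)

Definition pform (u v : U) : k := Phi (inSym u * X * inSym v).

Lemma pformC u v : pform u v = pform v u.
Proof. by rewrite /pform; congr (Phi _); ring. Qed.

(** Both sides are [Phi] of the product abc; thus multiplication operators are self-adjoint. *)
Lemma pform_umul a b c : pform (a ** b) c = pform a (b ** c).
Proof.
rewrite [RHS]pformC /pform !Phi_umul; congr (Phi _); ring.
Qed.

Lemma pform_pinv nu u : pform (pinv nu) u = nu u.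
Proof. exact: Phi_pinv. Qed.

Lemma pformDr u a b : pform u (a + b) = pform u a + pform u b.
Proof. by rewrite /pform linearD mulrDr linearD. Qed.

Lemma pformZr u c a : pform u (c *: a) = c * pform u a.
Proof. by rewrite /pform linearZ -scalerAr linearZ. Qed.

Lemma pformDl u a b : pform (a + b) u = pform a u + pform b u.
Proof. by rewrite ![pform _ u]pformC pformDr. Qed.

Lemma pformZl u c a : pform (c *: a) u = c * pform a u.
Proof. by rewrite ![pform _ u]pformC pformZr. Qed.

Lemma pformBl u a b : pform (a - b) u = pform a u - pform b u.
Proof. by rewrite -scaleN1r pformDl pformZl mulN1r. Qed.

Lemma pform_inj u v : (forall t, t \in [:: x; y; z; w] -> pform u t = pform v t) -> u = v.
Proof.
move=> e; apply: (p_form_inj Phi_deg no_linear wl) => t.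
rewrite -!/(pform _ _) (basis_expand t).
by rewrite !pformDr !pformZr !e // !inE eqxx ?orbT.
Qed.

Lemma br_umul a b c d : br a b c d = Phi (inSym a * inSym b * inSym (c ** d)).
Proof. by rewrite br.unlock umul.unlock. Qed.

Lemma brE a b c d : br a b c d = pform (a ** b) (c ** d).
Proof. by rewrite br_umul /pform Phi_umul. Qed.

Lemma brCl a b c d : br a b c d = br b a c d.
Proof. by rewrite !br_umul (mulrC (inSym a)). Qed.

Lemma brCr a b c d : br a b c d = br a b d c.
Proof. by rewrite !br_umul umulC. Qed.

Lemma brS a b c d : br a b c d = br c d a b.
Proof. by rewrite !brE pformC. Qed.

Lemma SM_entries :
  [/\ br z z w w = alpha + br z w z w, br y w z w = br y z w w,
      br y z z w = br y w z z &
      [/\ br y y w w = br y w y w, br y z y w = br y y z w &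
      br y y z z = br y z y z]].
Proof.
pose i1 : 'I_3 := lift ord0 ord0; pose i2 : 'I_3 := lift ord0 (lift ord0 ord0).
have E i j := (congr1 (fun A : 'M_3 => A i j) SM_eq).
have := E ord0 ord0; have := E ord0 i1; have := E ord0 i2.
have := E i1 i1; have := E i1 i2; have := E i2 i2.
rewrite !mxE /= => /subr0_eq e22 /subr0_eq e12 /subr0_eq e11.
move=> /subr0_eq e02 /subr0_eq e01 e00.
rewrite (brS y w z w) (brS y w z z) br.unlock.
by split; [rewrite -e00 subrK|exact: e01|exact: e02|].
Qed.

(* Orders the arguments of br along yy, yz, yw, zz, zw, ww. *)
Definition br_sort := (fun c d => brCl z y c d, fun c d => brCl w y c d, fun c d => brCl w z c d,
  fun a b => brCr a b z y, fun a b => brCr a b w y, fun a b => brCr a b w z,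
  (brS y z y y, brS y w y y, brS z z y y, brS z w y y, brS w w y y),
  (brS y w y z, brS z z y z, brS z w y z, brS w w y z),
  (brS z z y w, brS z w y w, brS w w y w),
  (brS z w z z, brS w w z z, brS w w z w)).

(** Turns nested products into brackets, so that entries of SM become statements about commuting
    multiplications. *)
Lemma pform_assoc a b c t : pform (a ** (b ** c)) t = br b c a t.
Proof. by rewrite umulC pform_umul brE. Qed.

Lemma br_x a b c : br a b c x = Phi (inSym a * inSym b * inSym c).
Proof. by rewrite br_umul umulxr. Qed.

(** Against x both sides give [Phi] of yzc. Against y, z, w their difference is zero or, up to sign,
    an entry of the third column of SM. *)
Lemma umul_yzCA c : c \in [:: y; z; w] -> y ** (z ** c) = z ** (y ** c).
Proof.
have [s00 s01 s02 [s11 s12 s22]] := SM_entries.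
rewrite !inE => hc; apply: pform_inj => t; rewrite !pform_assoc !inE => /or4P[] /eqP ->.
  by rewrite !br_x; congr (Phi _); ring.
all: by case/or3P: hc => /eqP ->; rewrite !br_sort ?s01 ?s02 ?s12 ?s22.
Qed.

(** The same test now meets the second column of SM. *)
Lemma umul_ywCA c : c \in [:: y; z; w] -> y ** (w ** c) = w ** (y ** c).
Proof.
have [s00 s01 s02 [s11 s12 s22]] := SM_entries.
rewrite !inE => hc; apply: pform_inj => t; rewrite !pform_assoc !inE => /or4P[] /eqP ->.
  by rewrite !br_x; congr (Phi _); ring.
all: by case/or3P: hc => /eqP ->; rewrite !br_sort ?s01 ?s02 ?s12 ?s11.
Qed.

(** Here the first column of SM appears. The entry [alpha] occurs for c = w paired with z and, with
    the opposite sign, for c = z paired with w, which is what the correction term records. *)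
Lemma umul_zwCA c : c \in [:: y; z; w] ->
  z ** (w ** c) = w ** (z ** c) + alpha *: (ws c *: pinv zs - zs c *: pinv ws).
Proof.
have [s00 s01 s02 [s11 s12 s22]] := SM_entries.
rewrite !inE => hc; apply: pform_inj => t; rewrite pformDl pformZl pformBl !pformZl.
rewrite !pform_assoc !pform_pinv !inE => /or4P[] /eqP ->.
  rewrite !br_x !DE !mulr0 subrr mulr0 addr0.
  by congr (Phi _); ring.
all: case/or3P: hc => /eqP ->; rewrite !DE.
all: by rewrite !br_sort ?s01 ?s02 ?s00; ring.
Qed.

(** Since y commutes with z and w, self-adjointness makes the correction term of [umul_zwCA] at l,
    paired with y ** l', antisymmetric in l and l'. Letting l, l' run through y, z, w and cancelling
    [alpha] gives the identities. *)
Lemma umul_coords : [/\ zs (y ** y) = 0, ws (y ** y) = 0, zs (y ** w) = 0,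
  ws (y ** z) = 0 & zs (y ** z) = ws (y ** w)].
Proof.
have H l l' : l \in [:: y; z; w] -> l' \in [:: y; z; w] ->
    alpha * (ws l * zs (y ** l') - zs l * ws (y ** l')) =
    pform (z ** (w ** l)) (y ** l') - pform (z ** (w ** l')) (y ** l).
  move=> hl hl'; rewrite {1}(umul_zwCA hl) pformDl pformZl pformBl !pformZl.
  rewrite (pform_pinv zs) (pform_pinv ws).
  suff -> : pform (w ** (z ** l)) (y ** l') = pform (z ** (w ** l')) (y ** l) by ring.
  rewrite (umulC _ _ w) pform_umul -(umul_ywCA hl') -pform_umul (umulC _ _ _ y).
  by rewrite (umul_yzCA hl) (umulC _ _ z) pform_umul pformC.
have [hy hz hw] : [/\ y \in [:: y; z; w], z \in [:: y; z; w] & w \in [:: y; z; w]].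
  by rewrite !inE !eqxx !orbT.
have aI a : alpha * a = 0 -> a = 0.
  by move/eqP; rewrite mulf_eq0 (negPf alpha_neq0) => /eqP.
have := H z z hz hz; have := H w w hw hw; have := H z w hz hw; have := H w z hw hz.
have := H z y hz hy; have := H y z hy hz; have := H w y hw hy; have := H y w hy hw.
rewrite !DE !mul0r !mul1r !subrr !mulr0 !sub0r ?subr0.
move=> e1 e2 e3 e4 e5 e6 e7 e8.
split; last first.
- apply/eqP; rewrite -subr_eq0; apply/eqP; apply: aI.
  by rewrite mulrBr e5 -[_ * ws _]opprK -mulrN e6 opprB subrr.
- by apply: aI; apply: oppr_inj; rewrite -mulrN e8 oppr0.
- exact: aI.
- by apply: aI; apply: oppr_inj; rewrite -mulrN e4 -opprB -e3 !oppr0.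
- by apply: aI; rewrite e2 -opprB -e1 oppr0.
Qed.

(** * Entries of the matrices *)

Lemma Phi_pinv_umul (u t : U) nu : Phi (inSym u * inSym (pinv nu) * inSym t) = nu (u ** t).
Proof.
by rewrite -pform_pinv pformC /pform Phi_umul; congr (Phi _); ring.
Qed.

(** The coordinate at t of the map A on u tensor nu, with p^-1 eliminated by self-adjointness. *)
Definition acoef (t u : U) (nu : dualU) : P :=
  inSym u * (nu t)%:MP - X * (nu (u ** t))%:MP.

Lemma mapAE u nu i : mapA Phi x y z w u nu i 0 = acoef (yzw y z w i) u nu.
Proof. by rewrite !mxE to_dualE Phi_pinv_umul addrC. Qed.

Lemma acoefN t u nu : acoef t (- u) nu = - acoef t u nu.
Proof.
by rewrite /acoef (linearN (@inSym k U)) umulC linearN /= [_ ** u]umulC linearN mpolyCN; ring.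
Qed.

Lemma mxAE i j : mxA Phi x y z w i j =
  let t := yzw y z w i in
  nth 0 [:: acoef t y ys - acoef t w ws; acoef t y zs; acoef t y ws; acoef t z ys;
     acoef t z zs - acoef t w ws; acoef t z ws; acoef t w ys; acoef t w zs] j.
Proof.
rewrite dual_form.unlock mxE summxE /=.
by case: j => [[|[|[|[|[|[|[|[|?]]]]]]]]] // H /=;
  rewrite !big_cons big_nil addr0 /= ?mapAE ?acoefN ?addr0.
Qed.

Let S0 r u : S r 0 u = 0. Proof. by rewrite SC linear0. Qed.
Let SN r a u : S r (- a) u = - S r a u. Proof. by rewrite SC linearN SC. Qed.

Lemma SprojU0 r a b : S r a (projU0 xs x b) = S r a b.
Proof.
rewrite /projU0 linearB linearZ /= (_ : S r a x = 0) ?scaler0 ?subr0 //.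
rewrite sym2P.unlock sym2_coordE !DE.
by case: r => [[|[|[|[|[|[|?]]]]]]] // H /=; rewrite !(mulr0, mul0r, addr0) mpolyC0.
Qed.

Lemma mxCE r j : mxC Phi xs x y z w r j =
  nth 0 [:: S r w (pinv ws) - S r y (pinv ys); - S r y (pinv zs); - S r y (pinv ws);
    - S r z (pinv ys); S r w (pinv ws) - S r z (pinv zs); - S r z (pinv ws);
    - S r w (pinv ys); - S r w (pinv zs)] j.
Proof.
have E u nu : (mapC Phi xs x y z w u nu r 0)%:MP = - S r u (pinv nu).
  by rewrite mxE mpolyCN -SprojU0 sym2P.unlock.
rewrite dual_form.unlock mxE mxE summxE.
by case: j => [[|[|[|[|[|[|[|[|?]]]]]]]]] // H /=;
  first [by rewrite big_cons big_nil addr0 E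
        |by rewrite !big_cons big_nil addr0 mpolyCD !E SN opprK addrC].
Qed.

(** The coordinates of D on u tensor [ys]; rotating y, z, w cyclically gives those for [zs] and
    [ws]. *)
Definition dcoef_y r u : P := X * (S r z (w ** u) - S r w (z ** u)) - W * S r z u + Z * S r w u.
Definition dcoef_z r u : P := X * (S r w (y ** u) - S r y (w ** u)) + W * S r y u - Y * S r w u.
Definition dcoef_w r u : P := X * (S r y (z ** u) - S r z (y ** u)) - Z * S r y u + Y * S r z u.

Lemma mapDE r u nu (q := fun a b => wedge_eval nu a b) : mapD Phi xs x y z w u nu r 0 =
  X * (S r z (q y w ** u) - S r w (q y z ** u) - S r y (q z w ** u))
  - W * S r (q y z) u + Z * S r (q y w) u - Y * S r (q z w) u.
Proof.
have sumE (t1 t2 t3 t4 t5 t6 : 'cV[P]_6) : (- t1 + t2 - t3 - t4 + t5 - t6) r 0 =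
    - t1 r 0 + t2 r 0 - t3 r 0 - t4 r 0 + t5 r 0 - t6 r 0 by rewrite !mxE.
have E f a b : tens f (sym2_coord x y z w a b) r 0 = f * S r a b.
  by rewrite mxE sym2P.unlock.
have E' f a b : tens f (sym2_coord x y z w a (projU0 xs x b)) r 0 = f * S r a b.
  by rewrite E SprojU0.
rewrite /mapD sumE.
transitivity (- (X * S r w (q y z ** u)) + X * S r z (q y w ** u) - X * S r y (q z w ** u)
  - W * S r (q y z) u + Z * S r (q y w) u - Y * S r (q z w) u); last by ring.
by rewrite umul.unlock; congr (- _ + _ - _ - _ + _ - _);
  [exact: E'|exact: E'|exact: E'|exact: E|exact: E|exact: E].
Qed.

Lemma wedge_evalE (nu : dualU) (a b : U) : wedge_eval nu a b = (nu a : k) *: b - (nu b : k) *: a.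
Proof. by []. Qed.

Let umul0 u : 0 ** u = 0. Proof. by rewrite umulC linear0. Qed.
Let umulN a u : (- a) ** u = - (a ** u). Proof. by rewrite umulC linearN umulC. Qed.

Lemma mapD_ys r u : mapD Phi xs x y z w u ys r 0 = dcoef_y r u.
Proof.
rewrite mapDE !wedge_evalE !DE !scale0r !scale1r !subr0 umul0 !(linear0 (S r _)) S0 /dcoef_y; ring.
Qed.

Lemma mapD_zs r u : mapD Phi xs x y z w u zs r 0 = dcoef_z r u.
Proof.
rewrite mapDE !wedge_evalE !DE !scale0r !scale1r !subr0 sub0r umul0 umulN.
rewrite !(linear0 (S r _)) !(linearN (S r _)) S0 SN /dcoef_z /=; ring.
Qed.

Lemma mapD_ws r u : mapD Phi xs x y z w u ws r 0 = dcoef_w r u.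
Proof.
rewrite mapDE !wedge_evalE !DE !scale0r !scale1r !subr0 !sub0r umul0 !umulN.
rewrite !(linear0 (S r _)) !(linearN (S r _)) S0 !SN /dcoef_w /=; ring.
Qed.

Lemma mxDE r j : mxD Phi xs x y z w r j =
  nth 0 [:: dcoef_y r y; dcoef_y r z; dcoef_y r w; dcoef_z r y; dcoef_z r z; dcoef_z r w;
    dcoef_w r y; dcoef_w r z] j.
Proof.
rewrite mxE summxE.
have eys := mapD_ys; have ezs := mapD_zs; have ews := mapD_ws.
rewrite dual_form.unlock in eys ezs ews *.
case: j => [[|[|[|[|[|[|[|[|?]]]]]]]]] // H /=; rewrite big_cons big_nil addr0 /=.
1-3: exact: eys.
1-3: exact: ezs.
all: exact: ews.
Qed.

Lemma mapBE i u nu (q := fun a b => wedge_eval nu a b) (t := yzw y z w i) :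
  mapB Phi x y z w u nu i 0 =
    - br y t (q z w) u + br z t (q y w) u - br w t (q y z) u.
Proof.
have E a b c : dual_coord y z w (to_dual Phi (inSym a * inSym (b ** c))) i 0 = br a t b c.
  by rewrite mxE to_dualE br_umul; congr (Phi _); ring.
have sumE (t1 t2 t3 : 'cV[k]_3) : (- t1 + t2 - t3) i 0 = - t1 i 0 + t2 i 0 - t3 i 0.
  by rewrite !mxE.
by rewrite -!E umul.unlock -sumE.
Qed.

Lemma br0 a b u : br a b 0 u = 0. Proof. by rewrite br_umul umul0 inSym0 mulr0 linear0. Qed.
Lemma brN a b c u : br a b (- c) u = - br a b c u.
Proof. by rewrite !br_umul umulN (linearN (@inSym k U)) mulrN linearN. Qed.

(** Every entry of B is zero or, up to sign, an entry of SM. The two constants that remain are the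
    units split off later. *)
Lemma mxBE i j : mxB Phi x y z w i j =
  (if (i == 1 :> nat) && (j == 2 :> nat) then alpha
   else if (i == 2 :> nat) && (j == 1 :> nat) then - alpha else 0)%:MP.
Proof.
have [s00 s01 s02 [s11 s12 s22]] := SM_entries.
have DE' := DE; rewrite dual_form.unlock in DE'.
rewrite mxE mxE summxE; congr (_%:MP).
case: i j => [[|[|[|?]]]] // Hi [[|[|[|[|[|[|[|[|?]]]]]]]]] // Hj /=;
  rewrite !big_cons big_nil addr0 /= mapBE yzwE /= !wedge_evalE !DE' !scale0r !scale1r;
  rewrite ?subr0 ?sub0r ?(br0, brN) ?br_sort;
  rewrite ?s00 ?s01 ?s02 ?s11 ?s12 ?s22; ring.
Qed.

(** * Isotropy of the rows of [d2] *)

Lemma mul_mxBT m (M : 'M[P]_(m, 8)) i j : (M *m B^T) i j =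
  if j == 1 :> nat then alpha%:MP * M i (inord 2)
  else if j == 2 :> nat then - (alpha%:MP * M i (inord 1)) else 0.
Proof.
have e1 : inord 1 = lift ord0 ord0 :> 'I_8 by apply: val_inj; rewrite /= inordK.
have e2 : inord 2 = lift ord0 (lift ord0 ord0) :> 'I_8 by apply: val_inj; rewrite /= inordK.
rewrite e1 e2 mxE !big_ord_recl big_ord0 ![B^T _ _]mxE !mxBE /=.
by case: j => [[|[|[|?]]]] // H /=; rewrite ?(mpolyC0, mpolyCN); ring.
Qed.

Lemma S_expand r e u : S r e u =
  (ys u)%:MP * S r e y + (zs u)%:MP * S r e z + (ws u)%:MP * S r e w.
Proof.
rewrite {1}(basis_expand u) !linearD !linearZ /= -!mul_mpolyC.
rewrite (_ : S r e x = 0) ?mulr0 ?add0r //.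
have DE' := DE; rewrite sym2P.unlock sym2_coordE !DE'.
by case: r => [[|[|[|[|[|[|?]]]]]]] // H /=; rewrite !(mulr0, mul0r, addr0) mpolyC0.
Qed.

Lemma S_umul_expand r e a u : S r e (a ** u) =
  (xs u)%:MP * S r e a + (ys u)%:MP * S r e (a ** y) + (zs u)%:MP * S r e (a ** z)
  + (ws u)%:MP * S r e (a ** w).
Proof.
rewrite {1}(basis_expand u) !linearD !linearZ /= umulxr //.
by rewrite -!mul_mpolyC.
Qed.

Lemma S_yz r c : c \in [:: y; z; w] -> S r w (y ** (z ** c)) = S r w (z ** (y ** c)).
Proof. by move=> hc; rewrite (umul_yzCA hc). Qed.

Lemma S_yw r c : c \in [:: y; z; w] -> S r z (y ** (w ** c)) = S r z (w ** (y ** c)).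
Proof. by move=> hc; rewrite (umul_ywCA hc). Qed.

Lemma S_zw r c : c \in [:: y; z; w] -> S r y (z ** (w ** c)) = S r y (w ** (z ** c)) +
  alpha%:MP * ((ws c)%:MP * S r y (pinv zs) - (zs c)%:MP * S r y (pinv ws)).
Proof.
move=> hc; rewrite (umul_zwCA hc).
by rewrite linearD linearZ linearB !linearZ /= -!mul_mpolyC mulrN.
Qed.

(** With c the basis vector of row i, the entry is X^2 times a signed sum of the relations [S_yz],
    [S_yw], [S_zw] at c; the term in B C^T cancels the [alpha]-term of [S_zw]. *)
Lemma mulADt i r : (A *m D^T + X ^+ 2 *: (B *m C^T)) i r = 0.
Proof.
have e1 : inord 1 = lift ord0 ord0 :> 'I_8 by apply: val_inj; rewrite /= inordK.
have e2 : inord 2 = lift ord0 (lift ord0 ord0) :> 'I_8 by apply: val_inj; rewrite /= inordK.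
have hc : nth 0 [:: y; z; w] i \in [:: y; z; w] by rewrite mem_nth // ltn_ord.
rewrite mxE [X in _ + X]mxE -[B *m _]trmxK trmx_mul trmxK [X in _ * X]mxE mul_mxBT.
rewrite e1 e2 mxE !big_ord_recl big_ord0 ![D^T _ _]mxE !mxAE !mxDE !mxCE /= yzwE.
rewrite /acoef /dcoef_y /dcoef_z /dcoef_w.
have := S_yz r hc; have := S_yw r hc; have := S_zw r hc.
move: (S r y (pinv zs)) (S r y (pinv ws)) => v1 v2.
(* Nested products are expanded into coordinates of simple ones, so that the remaining identity is
   polynomial. *)
have UE c := (S_umul_expand r y z (w ** c), S_umul_expand r y w (z ** c),
  S_umul_expand r z y (w ** c), S_umul_expand r z w (y ** c),
  S_umul_expand r w y (z ** c), S_umul_expand r w z (y ** c)).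
have SE a b := (S_expand r y (a ** b), S_expand r z (a ** b), S_expand r w (a ** b)).
have Ssym := (SC x y z w r z y, SC x y z w r w y, SC x y z w r w z).
have Usym := (umulC Phi x z y, umulC Phi x w y, umulC Phi x w z).
have aux (G L1 R1 L2 R2 L3 R3 : P) : L1 = R1 -> L2 = R2 -> L3 = R3 ->
    G = X ^+ 2 * ((L2 - R2) - (L3 - R3) - (L1 - R1)) -> G = 0.
  by move=> -> -> -> ->; rewrite !subrr mulr0.
rewrite !UE; case: i {hc} => [[|[|[|?]]]] // Hi /=; rewrite !DE !mpolyC0 mpolyC1 !Usym.
- rewrite !(SE y y) !(SE y z) !(SE y w) !Ssym => h1 h2 h3.
  apply: (aux _ _ _ _ _ _ _ h1 h2 h3); ring.
- rewrite !(SE y z) !(SE z z) !(SE z w) !Ssym => h1 h2 h3.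
  apply: (aux _ _ _ _ _ _ _ h1 h2 h3); ring.
- rewrite !(SE y w) !(SE z w) !(SE w w) !Ssym => h1 h2 h3.
  apply: (aux _ _ _ _ _ _ _ h1 h2 h3); ring.
Qed.

(** The images under p^-1 of the dual basis form the basis dual to x, y, z, w for [pform]. *)
Lemma dual_basis_expand u : u = pform u x *: pinv xs + pform u y *: pinv ys
  + pform u z *: pinv zs + pform u w *: pinv ws.
Proof.
apply: pform_inj => t.
rewrite !(pformDl, pformZl) !pform_pinv !inE => /or4P[] /eqP ->; rewrite !DE; ring.
Qed.

(** The form S r e tensor S s e' evaluated at (1 tensor c - c tensor 1) Omega, where Omega is the
    symmetric Casimir tensor of [pform]. *)
Definition dual_defect r s c e e' : P :=
  S r e (pinv xs) * S s e' (c ** x) + S r e (pinv ys) * S s e' (c ** y)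
  + S r e (pinv zs) * S s e' (c ** z) + S r e (pinv ws) * S s e' (c ** w)
  - S r e (c ** x) * S s e' (pinv xs) - S r e (c ** y) * S s e' (pinv ys)
  - S r e (c ** z) * S s e' (pinv zs) - S r e (c ** w) * S s e' (pinv ws).

(* Multiplication by c is self-adjoint for pform, and dual_defect measures
   the failure of this in terms of the S-coordinates. *)
Lemma dual_defect0 r s c e e' : dual_defect r s c e e' = 0.
Proof.
have SE r' e1 a : S r' e1 (c ** a) = (pform (c ** a) x)%:MP * S r' e1 (pinv xs)
    + (pform (c ** a) y)%:MP * S r' e1 (pinv ys)
    + (pform (c ** a) z)%:MP * S r' e1 (pinv zs)
    + (pform (c ** a) w)%:MP * S r' e1 (pinv ws).
  by rewrite {1}(dual_basis_expand (c ** a)) !linearD !linearZ /= -!mul_mpolyC.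
have sa a b : pform (c ** a) b = pform (c ** b) a.
  by rewrite umulC pform_umul pformC.
rewrite /dual_defect !SE (sa y x) (sa z x) (sa w x) (sa z y) (sa w y) (sa w z).
move: (pform _ _) (pform _ _) (pform _ _) (pform _ _) (pform _ _) (pform _ _) (pform _ _)
  (pform _ _) (pform _ _) (pform _ _) => p1 p2 p3 p4 p5 p6 p7 p8 p9 p10.
ring.
Qed.

(** The entry is a combination of values of [dual_defect]: those at c among y, z, w carry the
    coefficient X, those at c = x carry Y, Z, W. *)
Lemma mulCDt r s : (C *m D^T + D *m C^T) r s = 0.
Proof.
rewrite mxE !mxE !big_ord_recl !big_ord0 ![D^T _ _]mxE ![C^T _ _]mxE !mxCE !mxDE /=.
rewrite /dcoef_y /dcoef_z /dcoef_w.
pose dd := dual_defect r s.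
transitivity (X * (dd z y w - dd w y z - dd y z w + dd w z y + dd y w z - dd z w y)
  + W * (dd x y z - dd x z y) + Z * (dd x w y - dd x y w) + Y * (dd x z w - dd x w z)).
  have Ux c := umulxr c; have Uxl c := umulxl Phi_deg no_linear wl c.
  have Usym := (umulC Phi x z y, umulC Phi x w y, umulC Phi x w z).
  have Ssym r' := (SC x y z w r' z y, SC x y z w r' w y, SC x y z w r' w z).
  have Sx r' e : S r' e x = 0 by rewrite S_expand !DE !mpolyC0 !mul0r !addr0.
  rewrite /dd /dual_defect !Ux !Uxl !Sx !Usym !(Ssym r) !(Ssym s).
  ring.
by rewrite /dd !dual_defect0; ring.
Qed.

(** Together with [mxA_diag] this says that columns 1 and 2 of A, counted from 0, are one linear
    form times the unit vectors 1 and 2; hence A B^T is skew. *)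
Lemma mxA_zero (i : 'I_3) b :
  (nat_of_ord i, b) \in [:: (0, 1); (0, 2); (1, 2); (2, 1)]%N -> A i (inord b) = 0.
Proof.
have [yy_z yy_w yw_z yz_w _] :=
  umul_coords.
rewrite mxAE yzwE !inE /acoef => /or4P[] /eqP[-> ->]; rewrite inordK //= !DE.
- by rewrite yy_z mpolyC0; ring.
- by rewrite yy_w mpolyC0; ring.
- by rewrite yz_w mpolyC0; ring.
- by rewrite yw_z mpolyC0; ring.
Qed.

Lemma mxA_diag (i j : 'I_3) : i = 1%N :> nat -> j = 2 :> nat ->
  A i (inord 1) = A j (inord 2).
Proof.
have [_ _ _ _ e] :=
  umul_coords.
by move=> ei ej; rewrite !mxAE !yzwE ei ej !inordK //= /acoef !DE e.
Qed.

Lemma mulABt : A *m B^T + B *m A^T = 0.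
Proof.
rewrite -[B *m _]trmxK trmx_mul trmxK; apply/matrixP=> i j.
rewrite mxE [X in _ + X]mxE !mul_mxBT [RHS]mxE.
case: i j => [[|[|[|?]]]] // Hi [[|[|[|?]]]] // Hj /=; rewrite ?addr0 ?add0r //;
  first [by rewrite !mxA_zero // mulr0 ?oppr0 ?addr0
        |by rewrite (@mxA_diag (Ordinal Hi) (Ordinal Hj)) // addrC subrr
        |by rewrite (@mxA_diag (Ordinal Hj) (Ordinal Hi)) // addrC addNr].
Qed.

Lemma mulADt0 : A *m D^T + X ^+ 2 *: (B *m C^T) = 0.
Proof.
apply/matrixP=> i r; rewrite [RHS]mxE.
exact: mulADt.
Qed.

Lemma mulCDt0 : C *m D^T + D *m C^T = 0.
Proof.
apply/matrixP=> i r; rewrite [RHS]mxE.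
exact: mulCDt.
Qed.

Definition hyperbolic n : 'M[P]_(n + n) := block_mx 0 1%:M 1%:M 0.

Lemma d2_isotropic : d2 Phi xs x y z w *m hyperbolic 8 *m (d2 Phi xs x y z w)^T = 0.
Proof.
rewrite /d2 /hyperbolic mulmx_block !mulmx0 !mulmx1 !add0r !addr0 tr_block_mx mulmx_block.
have e1 : B *m (X ^+ 2 *: C)^T + A *m D^T = 0.
  by rewrite linearZ /= -scalemxAr addrC mulADt0.
have e2 : D *m A^T + X ^+ 2 *: C *m B^T = 0.
  by apply: trmx_inj; rewrite trmx0 -e1 linearD /= !trmx_mul !trmxK addrC.
have e3 : D *m (X ^+ 2 *: C)^T + X ^+ 2 *: C *m D^T = 0.
  by rewrite linearZ /= -scalemxAr -scalemxAl -scalerDr addrC mulCDt0 scaler0.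
by rewrite e1 e2 e3 addrC mulABt block_mx0.
Qed.

(** * The composite of [d1] and [d2] *)

Definition quad a b : P := inSym a * inSym b - X * inSym (a ** b).

Lemma f11E (j : 'I_3) : f11 Phi x y z w 0 j = X * inSym (pinv (nth 0 [:: ys; zs; ws] j)).
Proof. by rewrite mxE (yzw_dual_nth x y z w). Qed.

Lemma f12E (r : 'I_6) : f12 Phi x y z w 0 r =
  nth 0 [:: quad y y; quad y z; quad y w; quad z z; quad z w; quad w w] r.
Proof.
have -> : f12 Phi x y z w 0 r =
    quad (yzw y z w (inord (sym2_exp r).1)) (yzw y z w (inord (sym2_exp r).2)).
  by rewrite mxE sym2_indexE /quad umul.unlock.
rewrite !yzwE; case: r => [[|[|[|[|[|[|?]]]]]]] // H /=; rewrite !inordK //.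
Qed.

Lemma quadC a b : quad a b = quad b a.
Proof. by rewrite /quad umulC mulrC. Qed.

Lemma quad_linear a : linear (quad a).
Proof.
move=> c u v; rewrite /quad !linearP /= mulrDr -!scalerAr mulrDr scalerBr -scalerAr.
ring.
Qed.
HB.instance Definition _ a := GRing.isLinear.Build k U P _ (quad a) (quad_linear a).

Lemma quad_x a : quad a x = 0.
Proof. by rewrite /quad umulxr mulrC subrr. Qed.

Lemma quad_expand a u : quad a u =
  (ys u)%:MP * quad a y + (zs u)%:MP * quad a z + (ws u)%:MP * quad a w.
Proof.
rewrite {1}(basis_expand u) !linearD !linearZ /= quad_x scaler0 add0r.
by rewrite -!mul_mpolyC.
Qed.

(** [quad] is symmetric, bilinear and zero at x, so it factors through the product of the
    U_0-parts. *)
Lemma f12_S a b : \sum_r f12 Phi x y z w 0 r * S r a b = quad a b.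
Proof.
rewrite (quad_expand a b) [quad a y]quadC [quad a z]quadC [quad a w]quadC.
rewrite (quad_expand y a) (quad_expand z a) (quad_expand w a).
rewrite (quadC z y) (quadC w y) (quadC w z).
rewrite !big_ord_recl big_ord0 !f12E sym2P.unlock !sym2_coordE /=.
rewrite !mpolyCD !mpolyCM.
ring.
Qed.

(** Expand p^-1 nu and its product with u in the [pform]-dual basis. The component of the latter
    along [pinv xs] is nu u; it leaves the last term, which cancels on the kernel of ev. *)
Lemma f11_acoef u (nu : dualU) : nu x = 0 ->
  \sum_i f11 Phi x y z w 0 i * acoef (yzw y z w i) u nu =
  X * (quad u (pinv nu) + X * (nu u)%:MP * inSym (pinv xs)).
Proof.
move=> nux; rewrite !big_ord_recl big_ord0 !f11E !yzwE /= /acoef /quad.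
have ev : inSym (pinv nu) = (nu y)%:MP * inSym (pinv ys) + (nu z)%:MP * inSym (pinv zs)
    + (nu w)%:MP * inSym (pinv ws) :> P.
  rewrite {1}(dual_basis_expand (pinv nu)) !pform_pinv nux scale0r add0r.
  by rewrite !linearD !linearZ /= -!mul_mpolyC.
have eu : inSym (u ** pinv nu) = (nu u)%:MP * inSym (pinv xs)
    + (nu (u ** y))%:MP * inSym (pinv ys) + (nu (u ** z))%:MP * inSym (pinv zs)
    + (nu (u ** w))%:MP * inSym (pinv ws) :> P.
  rewrite {1}(dual_basis_expand (u ** pinv nu)) ![u ** pinv nu]umulC !pform_umul !pform_pinv umulxr.
  by rewrite !linearD !linearZ /= -!mul_mpolyC.
rewrite ev eu; ring.
Qed.

Lemma mul_f11_mxA j : (f11 Phi x y z w *m A) 0 j =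
  let F u nu := X * (quad u (pinv nu) + X * (nu u)%:MP * inSym (pinv xs)) in
  nth 0 [:: F y ys - F w ws; F y zs; F y ws; F z ys; F z zs - F w ws; F z ws; F w ys; F w zs] j.
Proof.
have [ey ez ew] : [/\ ys x = 0, zs x = 0 & ws x = 0] by rewrite !DE.
rewrite mxE /=; case: j => [[|[|[|[|[|[|[|[|?]]]]]]]]] // H /=;
  rewrite -?(f11_acoef _ ey) -?(f11_acoef _ ez) -?(f11_acoef _ ew) -?sumrB;
  apply: eq_bigr => i _; rewrite mxAE /=; ring.
Qed.

Lemma mul_f12_mxC j : (f12 Phi x y z w *m C) 0 j =
  let F u nu := - quad u (pinv nu) in
  nth 0 [:: F y ys - F w ws; F y zs; F y ws; F z ys; F z zs - F w ws; F z ws; F w ys; F w zs] j.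
Proof.
rewrite mxE /=; case: j => [[|[|[|[|[|[|[|[|?]]]]]]]]] // H /=;
  rewrite -!f12_S -!sumrN -?big_split /=;
  apply: eq_bigr => i _; rewrite mxCE /=; ring.
Qed.

(** The products of three basis vectors cancel as in a Koszul relation, and so do the terms linear
    in X. What is left is X^2 times commutators, of which only those of z and w can survive; B
    accounts for them. *)
Lemma mul_f12_mxD j : (f12 Phi x y z w *m D) 0 j =
  - (X ^+ 2 * inSym (nth 0 [:: z ** (w ** y) - w ** (z ** y); z ** (w ** z) - w ** (z ** z);
    z ** (w ** w) - w ** (z ** w); w ** (y ** y) - y ** (w ** y);
    w ** (y ** z) - y ** (w ** z); w ** (y ** w) - y ** (w ** w);
    y ** (z ** y) - z ** (y ** y); y ** (z ** z) - z ** (y ** z)] j)).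
Proof.
have E s3 s4 a1 a2 a3 a4 b1 b2 b3 b4 : \sum_r f12 Phi x y z w 0 r *
   (X * (S r a1 b1 - S r a2 b2) + s3 * S r a3 b3 + s4 * S r a4 b4) =
   X * (quad a1 b1 - quad a2 b2) + s3 * quad a3 b3 + s4 * quad a4 b4.
  rewrite -!f12_S -sumrB !mulr_sumr -!big_split /=.
  apply: eq_bigr => r _; ring.
have Ey u : \sum_r f12 Phi x y z w 0 r * dcoef_y r u =
    - (X ^+ 2 * inSym (z ** (w ** u) - w ** (z ** u))).
  transitivity (X * (quad z (w ** u) - quad w (z ** u)) + - W * quad z u + Z * quad w u).
    by rewrite -E; apply: eq_bigr => r _; rewrite /dcoef_y; ring.
  rewrite /quad linearB /=; ring.
have Ez u : \sum_r f12 Phi x y z w 0 r * dcoef_z r u =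
    - (X ^+ 2 * inSym (w ** (y ** u) - y ** (w ** u))).
  transitivity (X * (quad w (y ** u) - quad y (w ** u)) + W * quad y u + - Y * quad w u).
    by rewrite -E; apply: eq_bigr => r _; rewrite /dcoef_z; ring.
  rewrite /quad linearB /=; ring.
have Ew u : \sum_r f12 Phi x y z w 0 r * dcoef_w r u =
    - (X ^+ 2 * inSym (y ** (z ** u) - z ** (y ** u))).
  transitivity (X * (quad y (z ** u) - quad z (y ** u)) + - Z * quad y u + Y * quad z u).
    by rewrite -E; apply: eq_bigr => r _; rewrite /dcoef_w; ring.
  rewrite /quad linearB /=; ring.
rewrite mxE /=; case: j => [[|[|[|[|[|[|[|[|?]]]]]]]]] // H /=;
  under eq_bigr do rewrite mxDE /=.
1-3: exact: Ey.
1-3: exact: Ez.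
all: exact: Ew.
Qed.

Lemma d1_d2 : d1 Phi x y z w *m d2 Phi xs x y z w = 0.
Proof.
have mem : [/\ y \in [:: y; z; w], z \in [:: y; z; w] & w \in [:: y; z; w]].
  by rewrite !inE !eqxx !orbT.
have [hy hz hw] := mem.
rewrite /d1 /d2 mul_row_block -!scalemxAl -!scalemxAr -row_mx0; congr row_mx.
  apply/rowP=> j; rewrite mxE [X in X + _]mxE [X in _ + X]mxE mul_f11_mxA mul_f12_mxC mxE.
  case: j => [[|[|[|[|[|[|[|[|?]]]]]]]]] // H /=; rewrite !DE ?mpolyC0 ?mpolyC1; ring.
apply/rowP=> j; rewrite mxE [X in X + _]mxE mul_f12_mxD mxE [RHS]mxE.
rewrite !big_ord_recl big_ord0 !f11E !mxBE.
have e c : c \in [:: y; z; w] -> inSym (z ** (w ** c) - w ** (z ** c)) =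
    alpha%:MP * ((ws c)%:MP * inSym (pinv zs) - (zs c)%:MP * inSym (pinv ws)) :> P.
  move=> hc; rewrite (umul_zwCA hc) [_ ** _ + _]addrC addrK linearZ linearB !linearZ /=.
  by rewrite -!mul_mpolyC mulrN.
case: j => [[|[|[|[|[|[|[|[|?]]]]]]]]] // H /=.
1-3: rewrite e // !DE ?mpolyC0 ?mpolyC1 ?mpolyCN; ring.
all: rewrite ?(umul_yzCA hy) ?(umul_yzCA hz) ?(umul_ywCA hy) ?(umul_ywCA hz) ?(umul_ywCA hw).
all: rewrite subrr inSym0 mpolyC0; ring.
Qed.

(** * Exactness before reduction *)

Lemma linear_forms_decomposition (f : P) : exists (c : k) (f0 f1 f2 f3 : P),
  f = c%:MP + X * f0 + Y * f1 + Z * f2 + W * f3.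
Proof.
have [c [g eg]] := basis_decomposition xyzw_basis f.
exists c, (g 0), (g (lift ord0 0)), (g (lift ord0 (lift ord0 0))),
  (g (lift ord0 (lift ord0 (lift ord0 0)))).
by rewrite {1}eg !big_ord_recl big_ord0 /= addr0 !addrA.
Qed.

Lemma regular_y (f g : P) : Y * f = X * g -> exists h, f = X * h.
Proof.
move=> e; have [] := basis_regular xyzw_basis (r := inord 1) (f := f) (g := fun=> g).
  by rewrite big_mkcond !big_ord_recl big_ord0 !inordK //= !addr0.
move=> h; rewrite big_mkcond !big_ord_recl big_ord0 !inordK //= !addr0 => ->.
by eexists.
Qed.

Lemma regular_z (f g0 g1 : P) : Z * f = X * g0 + Y * g1 ->
  exists h0 h1, f = X * h0 + Y * h1.
Proof.
move=> e; have [] := basis_regular xyzw_basis (r := inord 2) (f := f)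
  (g := fun i => nth 0 [:: g0; g1] i).
  by rewrite big_mkcond !big_ord_recl big_ord0 !inordK //= !addr0.
move=> h; rewrite big_mkcond !big_ord_recl big_ord0 !inordK //= !addr0 => ->.
by do 2 eexists.
Qed.

Lemma regular_w (f g0 g1 g2 : P) : W * f = X * g0 + Y * g1 + Z * g2 ->
  exists h0 h1 h2, f = X * h0 + Y * h1 + Z * h2.
Proof.
move=> e; have [] := basis_regular xyzw_basis (r := inord 3) (f := f)
  (g := fun i => nth 0 [:: g0; g1; g2] i).
  by rewrite big_mkcond !big_ord_recl big_ord0 !inordK //= !addr0 addrA.
move=> h; rewrite big_mkcond !big_ord_recl big_ord0 !inordK //= !addr0 addrA => ->.
by do 3 eexists.
Qed.

Lemma X_neq0 : X != 0.
Proof.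
apply/eqP; rewrite -(inSym0 U) => /inSym_inj e.
by move: xs_x; rewrite e linear0 => /eqP; rewrite eq_sym oner_eq0.
Qed.

Lemma d1_col (a : 'cV[P]_3) (g : 'cV[P]_6) : d1 Phi x y z w *m col_mx a g =
  (X * (\sum_i f11 Phi x y z w 0 i * a i 0) + \sum_r f12 Phi x y z w 0 r * g r 0)%:M.
Proof.
rewrite /d1 mul_row_col -scalemxAl; apply/matrixP=> i j.
by rewrite !ord1 !mxE eqxx.
Qed.

(** * The entries of [d1] generate the annihilator *)

Definition imd1 (f : P) := exists u, f%:M = d1 Phi x y z w *m u.

Lemma imd1D f g : imd1 f -> imd1 g -> imd1 (f + g).
Proof. by move=> [u eu] [v ev]; exists (u + v); rewrite mulmxDr -eu -ev raddfD. Qed.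

Lemma imd1Mr f g : imd1 f -> imd1 (f * g).
Proof.
by move=> [u eu]; exists (g *: u); rewrite -scalemxAr -eu scale_scalar_mx mulrC.
Qed.

Lemma imd1_quad a b : imd1 (quad a b).
Proof.
exists (col_mx 0 (\col_r S r a b)); rewrite d1_col big1 => [|i _].
  rewrite mulr0 add0r -f12_S; congr (_%:M).
  by apply: eq_bigr => r _; rewrite [X in _ = _ * X]mxE.
by rewrite [X in _ * X]mxE mulr0.
Qed.

(** The hypothesis says that u is a combination of [pinv ys], [pinv zs], [pinv ws]; the coefficients
    are its pairings with y, z, w. *)
Lemma imd1_X2 u : pform u x = 0 -> imd1 (X ^+ 2 * inSym u).
Proof.
move=> ux; pose a : 'cV[P]_3 := \col_i (pform u (yzw y z w i))%:MP.
have aE i : a i 0 = (pform u (yzw y z w i))%:MP by rewrite mxE.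
exists (col_mx a 0); rewrite d1_col.
rewrite [X in _ + X]big1 => [|r _]; last by rewrite [X in _ * X]mxE mulr0.
rewrite !big_ord_recl big_ord0 !f11E !aE !yzwE /= {1}(dual_basis_expand u) ux scale0r add0r.
rewrite !linearD !linearZ /= -!mul_mpolyC; congr (_%:M); ring.
Qed.

Lemma imd1_X3 u : imd1 (X ^+ 3 * inSym u).
Proof.
(* [e] pairs to 1 with x, so u' falls under [imd1_X2]; and modulo [quad], X e is Y times [pinv ys],
   which X^2 brings into the ideal. *)
pose e := y ** pinv ys; pose u' := u - pform u x *: e.
have ux' : pform u' x = 0.
  rewrite /u' pformBl pformZl /e umulC pform_umul umulxr pform_pinv !DE; ring.
have -> : X ^+ 3 * inSym u = X ^+ 2 * inSym u' * X +
   (X ^+ 2 * inSym (pinv ys) * Y * (pform u x)%:MP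
    + quad y (pinv ys) * (- X ^+ 2 * (pform u x)%:MP)).
  by rewrite /u' /e linearB linearZ /= -mul_mpolyC /quad; ring.
apply: imd1D; first exact/imd1Mr/imd1_X2.
apply: imd1D; last exact/imd1Mr/imd1_quad.
by do 2 apply: imd1Mr; apply: imd1_X2; rewrite pform_pinv !DE.
Qed.

Lemma ann_quad a b : ann Phi (quad a b).
Proof.
apply: (@annP_homog _ _ _ Phi_deg 2 1) => // [|g /inSym_surj[c ->]].
  by apply: rpredB; apply: (@dhomogM _ _ _ 1 _ 1); apply: inSym_homog.
by rewrite /quad mulrBl linearB /= (mulrC X) Phi_umul subrr.
Qed.

Lemma ann_homog3 f : f \is 3.-homog -> Phi f = 0 -> ann Phi f.
Proof.
move=> hf f0 g; rewrite /contract.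
have [c [g0 [g1 [g2 [g3 ->]]]]] := linear_forms_decomposition g.
have Z4 u h : Phi (f * (inSym u * h)) = 0.
  rewrite mulrA; apply: (@ann_homog_gt _ _ _ Phi_deg 4) => //.
  by apply: (@dhomogM _ _ _ 3 _ 1) => //; apply: inSym_homog.
rewrite !mulrDr !linearD /= !Z4 !addr0 mulrC mul_mpolyC linearZ /= f0; exact: mulr0.
Qed.

Lemma ann_X2 u : pform u x = 0 -> ann Phi (X ^+ 2 * inSym u).
Proof.
move=> ux; apply: ann_homog3.
  by apply: (@dhomogM _ _ _ 2 _ 1); rewrite ?inSym_homog // expr2;
    apply: (@dhomogM _ _ _ 1 _ 1); apply: inSym_homog.
by rewrite -ux /pform; congr (Phi _); ring.
Qed.

Lemma annD f g : ann Phi f -> ann Phi g -> ann Phi (f + g).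
Proof. by move=> hf hg h; rewrite /contract mulrDl linearD /= [Phi _]hf [Phi _]hg addr0. Qed.

Lemma annMr f g : ann Phi f -> ann Phi (f * g).
Proof. by move=> hf h; rewrite /contract -mulrA; apply: hf. Qed.

Lemma ann0 : ann Phi 0.
Proof. by move=> h; rewrite /contract mul0r linear0. Qed.

Lemma imd1_ann f : imd1 f -> ann Phi f.
Proof.
case=> u; rewrite -[u]vsubmxK d1_col => /matrixP/(_ 0 0); rewrite mxE [RHS]mxE !mulr1n => ->.
have sum_ann n (F : 'I_n -> P) : (forall i, ann Phi (F i)) -> ann Phi (\sum_i F i).
  by move=> hF; apply: big_ind => //; [exact: ann0|exact: annD].
apply: annD; last first.
  apply: sum_ann => r; apply: annMr; rewrite f12E.
  by case: r => [[|[|[|[|[|[|?]]]]]]] // H /=; apply: ann_quad.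
rewrite mulr_sumr; apply: sum_ann => i; rewrite mulrA; apply: annMr.
rewrite f11E mulrA -expr2; apply: ann_X2; rewrite pform_pinv.
by case: i => [[|[|[|?]]]] // H /=; rewrite !DE.
Qed.

(** Modulo the quadrics, u a equals x (u ** a) for a among x, y, z, w; only the constant term of g
    leaves a linear form without the factor x. *)
Lemma linear_form_reduction u (g : P) : exists v (f0 f1 f2 f3 : P),
  imd1 (inSym u * g - (inSym v + X * (X * f0 + Y * f1 + Z * f2 + W * f3))).
Proof.
have [c [g0 [g1 [g2 [g3 ->]]]]] := linear_forms_decomposition g.
pose F (nu : U -> k) := (nu (u ** x))%:MP * g0 + (nu (u ** y))%:MP * g1
  + (nu (u ** z))%:MP * g2 + (nu (u ** w))%:MP * g3.
exists (c *: u), (F xs), (F ys), (F zs), (F ws).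
have e a : inSym (u ** a) = (xs (u ** a))%:MP * X + (ys (u ** a))%:MP * Y
   + (zs (u ** a))%:MP * Z + (ws (u ** a))%:MP * W :> P.
  by rewrite {1}(basis_expand (u ** a)) !linearD !linearZ /= -!mul_mpolyC.
rewrite [X in imd1 X](_ : _ = quad u x * g0 + (quad u y * g1 + (quad u z * g2 + quad u w * g3))).
  by do 3!(apply: imd1D; first exact/imd1Mr/imd1_quad); exact/imd1Mr/imd1_quad.
rewrite /quad !e linearZ /= -mul_mpolyC /F; ring.
Qed.

Lemma irrelevant_reduction (g0 g1 g2 g3 : P) : exists v (f0 f1 f2 f3 : P),
  imd1 (X * g0 + Y * g1 + Z * g2 + W * g3 -
        (inSym v + X * (X * f0 + Y * f1 + Z * f2 + W * f3))).
Proof.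
have [v0 [a0 [a1 [a2 [a3 ha]]]]] := linear_form_reduction x g0.
have [v1 [b0 [b1 [b2 [b3 hb]]]]] := linear_form_reduction y g1.
have [v2 [c0 [c1 [c2 [c3 hc]]]]] := linear_form_reduction z g2.
have [v3 [d0 [d1 [d2 [d3 hd]]]]] := linear_form_reduction w g3.
exists (v0 + v1 + v2 + v3), (a0 + b0 + c0 + d0), (a1 + b1 + c1 + d1),
  (a2 + b2 + c2 + d2), (a3 + b3 + c3 + d3).
have := imd1D (imd1D ha hb) (imd1D hc hd); congr imd1.
have D (a b : U) : inSym (a + b) = inSym a + inSym b :> P by rewrite linearD.
rewrite !D; ring.
Qed.

(** After three reductions the rest is x^3 times an element of the irrelevant ideal, which [imd1_X3]
    absorbs. *)
Lemma imd1_reduction (f : P) : exists c u0 u1 u2,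
  imd1 (f - (c%:MP + inSym u0 + X * inSym u1 + X ^+ 2 * inSym u2)).
Proof.
have [c [g0 [g1 [g2 [g3 ef]]]]] := linear_forms_decomposition f.
have [u0 [a0 [a1 [a2 [a3 ha]]]]] := irrelevant_reduction g0 g1 g2 g3.
have [u1 [b0 [b1 [b2 [b3 hb]]]]] := irrelevant_reduction a0 a1 a2 a3.
have [u2 [c0 [c1 [c2 [c3 hc]]]]] := irrelevant_reduction b0 b1 b2 b3.
exists c, u0, u1, u2.
rewrite [X in imd1 X](_ : _ = (X * g0 + Y * g1 + Z * g2 + W * g3 -
        (inSym u0 + X * (X * a0 + Y * a1 + Z * a2 + W * a3))) +
  ((X * a0 + Y * a1 + Z * a2 + W * a3 -
        (inSym u1 + X * (X * b0 + Y * b1 + Z * b2 + W * b3))) * X +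
  ((X * b0 + Y * b1 + Z * b2 + W * b3 -
        (inSym u2 + X * (X * c0 + Y * c1 + Z * c2 + W * c3))) * X ^+ 2 +
  (X ^+ 3 * X * c0 + (X ^+ 3 * Y * c1 + (X ^+ 3 * Z * c2 + X ^+ 3 * W * c3)))))); last first.
  rewrite ef; ring.
apply: imd1D => //; do 2!(apply: imd1D; first exact: imd1Mr).
by do 3!(apply: imd1D; first exact/imd1Mr/imd1_X3); exact/imd1Mr/imd1_X3.
Qed.

(** The normal form c + u0 + x u1 + x^2 u2 of f annihilates [Phi]. As [Phi] sees only degree 3,
    testing against t, x t, 1 and x y [pinv ys] gives in turn u1 = 0, u0 = 0, [pform u2 x = 0] and c
    = 0. *)
Lemma ann_imd1 f : ann Phi f <-> imd1 f.
Proof.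
split; last exact: imd1_ann.
move=> hf; have [c [u0 [u1 [u2 hI]]]] := imd1_reduction f.
have hr : ann Phi (c%:MP + inSym u0 + X * inSym u1 + X ^+ 2 * inSym u2).
  move=> g; have := hf g; rewrite /contract.
  rewrite -{1}[f](subrK (c%:MP + inSym u0 + X * inSym u1 + X ^+ 2 * inSym u2)).
  by rewrite mulrDl linearD /= [X in X + _ = _](imd1_ann hI) add0r.
have H1 u : inSym u \is 1.-homog := inSym_homog u.
have hM := @homogM k (\dim {:U}).
have ev (g : P) : Phi (c%:MP * g) + Phi (inSym u0 * g) + Phi (X * inSym u1 * g)
    + Phi (X ^+ 2 * inSym u2 * g) = 0.
  by have := hr g; rewrite /contract !mulrDl !linearD.
have hC := @homog_mpolyC k (\dim {:U}) c.
have hX2 : X ^+ 2 \is 2.-homog by rewrite expr2; apply: (hM 1 1).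
have inj u : (forall t, pform u t = 0) -> u = 0.
  move=> e; apply: pform_inj => t _.
  by rewrite e -(scale0r (0 : U)) pformZl mul0r.
have u1_0 : u1 = 0.
  apply: inj => t; have := ev (inSym t).
  rewrite (@Phi_deg (0 + 1) (c%:MP * _)) //; last exact: hM.
  rewrite (@Phi_deg (1 + 1) (inSym u0 * _)) //; last exact: hM.
  rewrite (@Phi_deg (2 + 1 + 1) (_ * inSym u2 * _)) //; last exact: (hM _ _ _ _ (hM _ _ _ _ _ _)).
  by rewrite add0r addr0 add0r (mulrC X).
have u0_0 : u0 = 0.
  apply: inj => t; have := ev (X * inSym t).
  rewrite (@Phi_deg (0 + (1 + 1)) (c%:MP * _)) //; last exact: (hM _ _ _ _ _ (hM _ _ _ _ _ _)).
  rewrite u1_0 inSym0 mulr0 mul0r linear0.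
  rewrite (@Phi_deg (2 + 1 + (1 + 1)) (_ * inSym u2 * _)) //;
    last exact: (hM _ _ _ _ (hM _ _ _ _ _ _) (hM _ _ _ _ _ _)).
  by rewrite add0r !addr0 mulrA.
have u2x : pform u2 x = 0.
  have := ev 1; rewrite u1_0 u0_0 inSym0 !mulr0 mul0r linear0 !addr0 !mulr1.
  rewrite (@Phi_deg 0 (c%:MP)) // add0r => e2.
  by rewrite -e2 /pform; congr (Phi _); ring.
have c0 : c = 0.
  have := ev (X * (Y * inSym (pinv ys))); rewrite u1_0 u0_0 inSym0 !mulr0 !mul0r linear0 !addr0.
  rewrite (@Phi_deg (2 + 1 + (1 + (1 + 1))) (_ * inSym u2 * _)) //;
    last exact: (hM _ _ _ _ (hM _ _ _ _ _ _) (hM _ _ _ _ _ (hM _ _ _ _ _ _))).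
  rewrite addr0 mul_mpolyC linearZ /=.
  have -> : Phi (X * (Y * inSym (pinv ys))) = 1.
    have := pform_pinv ys y; rewrite DE => <-; rewrite /pform; congr (Phi _); ring.
  by rewrite -[X in X = 0]/(c * 1) mulr1.
move: hI; rewrite c0 u0_0 u1_0 inSym0 mulr0 mpolyC0 !add0r => hI.
by rewrite -[f](subrK (X ^+ 2 * inSym u2)); apply: imd1D => //; apply: imd1_X2.
Qed.

(** * Syzygies of [d1] *)

Lemma S_basis r : [/\ S r y y = (r == 0 :> nat)%:R, S r y z = (r == 1 :> nat)%:R,
  S r y w = (r == 2 :> nat)%:R & [/\ S r z z = (r == 3 :> nat)%:R,
  S r z w = (r == 4 :> nat)%:R & S r w w = (r == 5 :> nat)%:R]].
Proof.
rewrite sym2P.unlock !sym2_coordE !DE !(mulr0, mul0r, mulr1, addr0, add0r).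
by case: r => [[|[|[|[|[|[|?]]]]]]] // H /=; rewrite !mpolyC0 !mpolyC1.
Qed.

(** Modulo x the columns of D are the eight linear syzygies of the monomials y^2, yz, yw, z^2, zw,
    w^2; [h] collects the multiples of x. *)
Lemma mulD_col (t : seq P) : exists h, forall r,
  (D *m \col_(j < 8) t`_j) r 0 = X * h r +
  nth 0 [:: W * t`_3 - Z * t`_6; W * (t`_4 - t`_0) + Y * t`_6 - Z * t`_7;
    Z * t`_0 - Y * t`_3 + W * t`_5; Y * t`_7 - W * t`_1; Z * t`_1 - W * t`_2 - Y * t`_4;
    Z * t`_2 - Y * t`_5] r.
Proof.
pose hy r u := S r z (w ** u) - S r w (z ** u).
pose hz r u := S r w (y ** u) - S r y (w ** u).
pose hw r u := S r y (z ** u) - S r z (y ** u).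
exists (fun r => hy r y * t`_0 + hy r z * t`_1 + hy r w * t`_2 + hz r y * t`_3 + hz r z * t`_4
  + hz r w * t`_5 + hw r y * t`_6 + hw r z * t`_7) => r.
have tE j : (\col_(j < 8) t`_j) j 0 = t`_j by rewrite mxE.
rewrite mxE !big_ord_recl big_ord0 !tE !mxDE /= /dcoef_y /dcoef_z /dcoef_w /hy /hz /hw.
have [e0 e1 e2 [e3 e4 e5]] := S_basis r.
rewrite (SC x y z w r z y) (SC x y z w r w y) (SC x y z w r w z) e0 e1 e2 e3 e4 e5.
by case: r {e0 e1 e2 e3 e4 e5} => [[|[|[|[|[|[|?]]]]]]] // H /=; ring.
Qed.

Lemma mulA_col (t : seq P) : exists h, forall i,
  (A *m \col_(j < 8) t`_j) i 0 = X * h i +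
  nth 0 [:: Y * t`_0 + Z * t`_3 + W * t`_6; Y * t`_1 + Z * t`_4 + W * t`_7;
    Y * t`_2 + Z * t`_5 - W * (t`_0 + t`_4)] i.
Proof.
pose h (i : 'I_3) (u : U) (nu : dualU) : P := (nu (u ** yzw y z w i))%:MP.
exists (fun i => - (h i y ys - h i w ws) * t`_0 - h i y zs * t`_1 - h i y ws * t`_2
  - h i z ys * t`_3 - (h i z zs - h i w ws) * t`_4 - h i z ws * t`_5 - h i w ys * t`_6
  - h i w zs * t`_7) => i.
have tE j : (\col_(j < 8) t`_j) j 0 = t`_j by rewrite mxE.
rewrite mxE !big_ord_recl big_ord0 !tE !mxAE /= /acoef /h !yzwE.
by case: i => [[|[|[|?]]]] // H /=; rewrite !DE !mpolyC0 mpolyC1; ring.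
Qed.

(* Successive elimination along the regular sequence x, y, z, w: the linear
   syzygies of (y, z, w)^2 generate all its syzygies modulo x. *)
Lemma linear_syzygies_mod (g0 g1 g2 g3 g4 g5 q : P) :
  Y * Y * g0 + Y * Z * g1 + Y * W * g2 + Z * Z * g3 + Z * W * g4 + W * W * g5 = X * q ->
  exists t0 t1 t2 t3 t4 t5 t6 t7 a0 a1 a2 a3 a4 a5 : P,
  [/\ g0 = W * t3 - Z * t6 + X * a0, g1 = W * (t4 - t0) + Y * t6 - Z * t7 + X * a1,
      g2 = Z * t0 - Y * t3 + W * t5 + X * a2 & [/\ g3 = Y * t7 - W * t1 + X * a3,
      g4 = Z * t1 - W * t2 - Y * t4 + X * a4 & g5 = Z * t2 - Y * t5 + X * a5]].
Proof.
move=> e.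
(* Only the last monomial avoids x, y and z; its factor W is cancelled twice. *)
have [u0 [u1 [u2 eu]]] : exists u0 u1 u2, W * g5 = X * u0 + Y * u1 + Z * u2.
  apply: (@regular_w _ q (- (Y * g0 + Z * g1 + W * g2)) (- (Z * g3 + W * g4))).
  by rewrite -e; ring.
have [a5 [b5 [c5 e5]]] := regular_w eu.
have [v0 [v1 ev]] : exists v0 v1, Z * g3 + W * (g4 + W * c5) = X * v0 + Y * v1.
  apply: (@regular_z _ (q - W * W * a5) (- (Y * g0 + Z * g1 + W * (g2 + W * b5)))).
  by rewrite mulrBr -e e5; ring.
have [a4 [b4 [c4 e4]]] : exists a b c, g4 + W * c5 = X * a + Y * b + Z * c.
  by apply: (@regular_w _ v0 v1 (- g3)); rewrite -ev; ring.
have [w0 [w1 ew]] : exists w0 w1, Z * (g3 + W * c4) = X * w0 + Y * w1.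
  exists (v0 - W * a4), (v1 - W * b4); rewrite !mulrBr.
  have -> : X * v0 - X * (W * a4) + (Y * v1 - Y * (W * b4)) =
    X * v0 + Y * v1 - (X * a4 + Y * b4 + Z * c4) * W + Z * W * c4 by ring.
  by rewrite -ev -e4; ring.
have [a3 [b3 e3]] := regular_z ew.
have [p ep] : exists p, Y * g0 + Z * (g1 + W * b4 + Z * b3) + W * (g2 + W * b5) = X * p.
  apply: (@regular_y _ (q - W * W * a5 - Z * W * a4 - Z * Z * a3)).
  rewrite !mulrBr -e e5.
  have -> : g4 = X * a4 + Y * b4 + Z * c4 - W * c5 by rewrite -e4; ring.
  have -> : g3 = X * a3 + Y * b3 - W * c4 by rewrite -e3; ring.
  ring.
have [a2 [b2 [c2 e2]]] : exists a b c, g2 + W * b5 = X * a + Y * b + Z * c.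
  by apply: (@regular_w _ p (- g0) (- (g1 + W * b4 + Z * b3))); rewrite -ep; ring.
have [a1 [b1 e1]] : exists a b, g1 + W * b4 + Z * b3 + W * c2 = X * a + Y * b.
  apply: (@regular_z _ (p - W * a2) (- (g0 + W * b2))).
  by rewrite mulrBr -ep e2; ring.
have [a0 e0] : exists a, g0 + W * b2 + Z * b1 = X * a.
  apply: (@regular_y _ (p - W * a2 - Z * a1)).
  have e1' : Z * (X * a1 + Y * b1) = Z * (g1 + W * b4 + Z * b3 + W * c2) by rewrite e1.
  have e2' : W * (X * a2 + Y * b2 + Z * c2) = W * (g2 + W * b5) by rewrite e2.
  have -> : X * (p - W * a2 - Z * a1) = X * p - Z * (X * a1 + Y * b1) + Z * Y * b1
     - W * (X * a2 + Y * b2 + Z * c2) + W * Y * b2 + W * Z * c2 by ring.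
  by rewrite e1' e2' -ep; ring.
exists c2, c4, c5, (- b2), (- b4), (- b5), b1, b3, a0, a1, a2, a3, a4, a5.
have sub (p1 p2 p3 p4 : P) : p3 = p4 -> p1 - p2 = p3 - p4 -> p1 = p2.
  by move=> -> /eqP; rewrite subrr subr_eq0 => /eqP.
split; last split.
- by apply: (sub _ _ _ _ e0); ring.
- by apply: (sub _ _ _ _ e1); ring.
- by apply: (sub _ _ _ _ e2); ring.
- by apply: (sub _ _ _ _ e3); ring.
- by apply: (sub _ _ _ _ e4); ring.
- by apply: (sub _ _ _ _ e5); ring.
Qed.

(** Modulo x the entries of [f12] are monomials: their terms x (a ** b) are moved to the side of
    q. *)
Lemma linear_syzygies (g : 'cV[P]_6) q :
  \sum_r f12 Phi x y z w 0 r * g r 0 = X * q -> exists t g', g = D *m t + X *: g'.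
Proof.
pose o i : 'I_6 := inord i.
have E (F : 'I_6 -> P) : \sum_r F r = F (o 0) + F (o 1) + F (o 2) + F (o 3) + F (o 4) + F (o 5).
  rewrite !big_ord_recl big_ord0 addr0 !addrA.
  by do !congr (_ + _); congr F; apply: val_inj; rewrite /= inordK.
rewrite E !f12E !inordK //= /quad => e.
have [|t0 [t1 [t2 [t3 [t4 [t5 [t6 [t7 [a0 [a1 [a2 [a3 [a4 [a5 [e0 e1 e2 [e3 e4 e5]]]]]]]]]]]]]]]] :=
  @linear_syzygies_mod (g (o 0) 0) (g (o 1) 0) (g (o 2) 0) (g (o 3) 0) (g (o 4) 0) (g (o 5) 0)
    (q + inSym (y ** y) * g (o 0) 0 + inSym (y ** z) * g (o 1) 0 + inSym (y ** w) * g (o 2) 0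
     + inSym (z ** z) * g (o 3) 0 + inSym (z ** w) * g (o 4) 0 + inSym (w ** w) * g (o 5) 0).
  by rewrite !mulrDr -e; ring.
have [h hE] := mulD_col [:: t0; t1; t2; t3; t4; t5; t6; t7].
exists (\col_(j < 8) [:: t0; t1; t2; t3; t4; t5; t6; t7]`_j).
exists (\col_r ([:: a0; a1; a2; a3; a4; a5]`_r - h r)).
have gE r : g r 0 = nth 0 [:: g (o 0) 0; g (o 1) 0; g (o 2) 0; g (o 3) 0; g (o 4) 0; g (o 5) 0] r.
  by case: r => [[|[|[|[|[|[|?]]]]]]] // H; congr (g _ _); apply: val_inj; rewrite /= inordK.
have g'E r : (X *: \col_r ([:: a0; a1; a2; a3; a4; a5]`_r - h r)) r 0 =
    X * ([:: a0; a1; a2; a3; a4; a5]`_r - h r) :> P by rewrite !mxE.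
apply/colP=> r; rewrite gE [RHS]mxE hE g'E.
case: r => [[|[|[|[|[|[|?]]]]]]] // H; rewrite /= ?e0 ?e1 ?e2 ?e3 ?e4 ?e5 /=; ring.
Qed.

(** Modulo x, A is induced by the inclusion of the kernel of ev, a hyperplane complementary to y
    tensor y^*. Hence [c'] is the only remainder in degree 1, and higher degrees are absorbed. *)
Lemma dual_part_reduction (a : 'cV[P]_3) :
  exists (t : 'cV[P]_8) (c : 'I_3 -> k) (c' : k) (b : 'cV[P]_3),
  forall i : 'I_3, a i 0 = (A *m t) i 0 + (c i)%:MP + (if i == 0 :> nat then c'%:MP * Y else 0)
    + X * b i 0.
Proof.
have [c [f hf]] : exists (c : 'I_3 -> k) (f : 'I_3 -> seq P), forall i,
    a i 0 = (c i)%:MP + X * (f i)`_0 + Y * (f i)`_1 + Z * (f i)`_2 + W * (f i)`_3.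
  have H i : exists cf : k * seq P, a i 0 =
      cf.1%:MP + X * cf.2`_0 + Y * cf.2`_1 + Z * cf.2`_2 + W * cf.2`_3.
    have [c [f0 [f1 [f2 [f3 e]]]]] := linear_forms_decomposition (a i 0).
    by exists (c, [:: f0; f1; f2; f3]).
  have [cf hcf] := fin_all_exists H.
  by exists (fun i => (cf i).1), (fun i => (cf i).2).
pose o i : 'I_3 := inord i; pose F i j := (f (o i))`_j.
(* This is the trace of the coefficients, the obstruction to lying in the kernel of ev; the terms of
   [t] in F1, F2, F3 remove its part in (y, z, w). *)
have [c' [F0 [F1 [F2 [F3 eF]]]]] := linear_forms_decomposition (F 0 1 + F 1 2 + F 2 3).
pose t := [:: - F 2 3 - F 1 2 + Y * F1; F 1 1 + Z * F1; F 2 1; F 0 2 + Y * F2;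
  F 1 2 - Y * F1; F 2 2; F 0 3 + Y * F3; F 1 3].
have [h hE] := mulA_col t.
exists (\col_(j < 8) t`_j), c, c'.
exists (\col_i ((f i)`_0 - h i + (if i == 0 :> nat then Y * F0 else 0))) => i.
rewrite hE [X in _ + _ * X]mxE hf.
have fE j : (f i)`_j = nth 0 [:: F 0 j; F 1 j; F 2 j] i.
  rewrite /F; case: i => [[|[|[|?]]]] // H /=; congr ((f _)`_j);
  by apply: val_inj; rewrite /= inordK.
rewrite !fE; case: i {fE} => [[|[|[|?]]]] // H /=.
- have -> : F 0 1 = c'%:MP + X * F0 + Y * F1 + Z * F2 + W * F3 - F 1 2 - F 2 3.
    by rewrite -eF; ring.
  ring.
- ring.
- ring.
Qed.

Lemma f12_ann (g : 'cV[P]_6) : ann Phi (\sum_r f12 Phi x y z w 0 r * g r 0).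
Proof.
apply/ann_imd1; exists (col_mx 0 g); rewrite d1_col.
have -> : \sum_i f11 Phi x y z w 0 i * (0 : 'cV[P]_3) i 0 = 0.
  by apply: big1 => i _; rewrite [X in _ * X]mxE mulr0.
by rewrite mulr0 add0r.
Qed.

Let L (a : 'cV[P]_3) := \sum_(i < 3) inSym (pinv (nth 0 [:: ys; zs; ws] i)) * a i 0.

Lemma f11_sum (a : 'cV[P]_3) : \sum_i f11 Phi x y z w 0 i * a i 0 = X * L a.
Proof. by rewrite /L mulr_sumr; apply: eq_bigr => i _; rewrite f11E mulrA. Qed.

Lemma f12_scale (c : P) (g : 'cV[P]_6) : \sum_r f12 Phi x y z w 0 r * (c *: g) r 0 =
  c * \sum_r f12 Phi x y z w 0 r * g r 0.
Proof.
by rewrite mulr_sumr; apply: eq_bigr => r _; rewrite [X in _ * X]mxE mulrCA.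
Qed.

Lemma d1_col_eq0 a g : d1 Phi x y z w *m col_mx a g = 0 ->
  \sum_r f12 Phi x y z w 0 r * g r 0 = - (X ^+ 2 * L a).
Proof.
rewrite d1_col f11_sum => /matrixP/(_ 0 0); rewrite mxE [RHS]mxE mulr1n.
by move/eqP; rewrite addrC addr_eq0 mulrA -expr2 => /eqP.
Qed.

(** Multiply by x h and apply [Phi]: the last two summands vanish, because X^2 L b and the
    [f12]-part annihilate [Phi]. Taking h = 1 isolates [c'], and h linear then isolates the
    [c i]. *)
Lemma dual_constants_eq0 (c : 'I_3 -> k) (c' : k) (b : 'cV[P]_3) (g : 'cV[P]_6) :
  \sum_(i < 3) inSym (pinv (nth 0 [:: ys; zs; ws] i)) * (c i)%:MP + c'%:MP * Y * inSym (pinv ys)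
    + X * L b + \sum_r f12 Phi x y z w 0 r * g r 0 = 0 ->
  (forall i, c i = 0) /\ c' = 0.
Proof.
set v := \sum_i _ => e; pose u0 := \sum_(i < 3) c i *: pinv (nth 0 [:: ys; zs; ws] i).
have ev : v = inSym u0.
  rewrite linear_sum; apply: eq_bigr => i _ /=.
  by rewrite linearZ /= -mul_mpolyC mulrC.
have H1 u : inSym u \is 1.-homog := inSym_homog u.
have hM := @homogM k (\dim {:U}).
have hC := @homog_mpolyC k (\dim {:U}).
have annL h : Phi (X * L b * (X * h)) = 0.
  suff : ann Phi (X ^+ 2 * L b) by move/(_ h); rewrite /contract expr2; congr (Phi _ = _); ring.
  rewrite /L mulr_sumr; apply: big_ind => [|p q|i _]; [exact: ann0|exact: annD|].
  rewrite mulrA; apply: annMr; apply: ann_X2; rewrite pform_pinv.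
  by case: i => [[|[|[|?]]]] // H /=; rewrite !DE.
have P0 h : Phi (inSym u0 * (X * h)) + Phi (c'%:MP * Y * inSym (pinv ys) * (X * h)) = 0.
  have gz : Phi ((\sum_r f12 Phi x y z w 0 r * g r 0) * (X * h)) = 0 := f12_ann g (X * h).
  have := congr1 (fun p => Phi (p * (X * h))) e.
  by rewrite /= ev mul0r linear0 !mulrDl !linearD /= annL gz !addr0.
have c'0 : c' = 0.
  have := P0 1; rewrite !mulr1 (Phi_deg (d := 2)) ?add0r //; last exact: (hM 1 1).
  rewrite -!mulrA mul_mpolyC linearZ /=.
  have -> : Phi (Y * (inSym (pinv ys) * X)) = 1.
    have := pform_pinv ys y; rewrite DE => <-; rewrite /pform; congr (Phi _); ring.
  by rewrite -[X in X = 0]/(c' * 1) mulr1.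
split=> // i.
have u0E t : pform u0 t = 0.
  have := P0 (inSym t); rewrite c'0 mpolyC0 !mul0r linear0 addr0 => <-.
  by rewrite /pform mulrA.
rewrite -(u0E (nth 0 [:: y; z; w] i)) /u0 !big_ord_recl big_ord0 addr0 !pformDl !pformZl /=.
rewrite !pform_pinv; case: i => [[|[|[|?]]]] // H /=; rewrite !DE !mulr0 ?addr0 ?add0r mulr1;
  by congr c; apply: val_inj.
Qed.

Lemma syzygy_step (v : 'cV[P]_(3 + 6)) : d1 Phi x y z w *m v = 0 ->
  exists t v', v = d2 Phi xs x y z w *m t + X *: v' /\ d1 Phi x y z w *m v' = 0.
Proof.
have d1d2 (t : 'cV[P]_(8 + 8)) (v' : 'cV[P]_(3 + 6)) : d1 Phi x y z w *m v' = 0 ->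
    d1 Phi x y z w *m (v' - d2 Phi xs x y z w *m t) = 0.
  by move=> e; rewrite mulmxBr e mulmxA d1_d2 mul0mx subrr.
have d2_col (t1 t2 : 'cV[P]_8) : d2 Phi xs x y z w *m col_mx t1 t2 =
    col_mx (A *m t1 + B *m t2) (X ^+ 2 *: (C *m t1) + D *m t2).
  by rewrite /d2 mul_block_col scalemxAl.
rewrite -[v]vsubmxK; move: (usubmx v) (dsubmx v) => a g e1.
(* The relation reads f12 g = - X^2 L a, so its right-hand side is divisible by x. *)
have [t [g1 eg]] : exists t g1, g = D *m t + X *: g1.
  by apply: (linear_syzygies (q := - (X * L a))); rewrite (d1_col_eq0 e1) expr2; ring.
have {}e1 := d1d2 (col_mx 0 t) _ e1.
rewrite d2_col !mulmx0 scaler0 !add0r opp_col_mx add_col_mx {1}eg addrAC subrr add0r in e1.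
set a1 := a - B *m t in e1.
(* After cancelling one x the right-hand side is still divisible by x, so g becomes divisible by x^2
   modulo the columns of [d2]. *)
have [t' [g2 eg1]] : exists t g2, g1 = D *m t + X *: g2.
  apply: (linear_syzygies (q := - L a1)); apply: (mulfI X_neq0).
  by rewrite -f12_scale (d1_col_eq0 e1); ring.
have {}e1 := d1d2 (col_mx 0 (X *: t')) _ e1.
rewrite d2_col !mulmx0 scaler0 !add0r opp_col_mx add_col_mx {1}eg1 in e1.
rewrite scalerDr -!scalemxAr [X *: _ + _ - _]addrAC subrr add0r scalerA -expr2 in e1.
set a2 := a1 - _ in e1.
(* Subtracting A t3 changes the lower part by X^2 C t3, which keeps its factor x^2. *)
have [t3 [c [c' [b a2E]]]] := dual_part_reduction a2.
have {}e1 := d1d2 (col_mx t3 0) _ e1.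
rewrite d2_col !mulmx0 !addr0 opp_col_mx add_col_mx -scalerBr in e1.
set g3 := g2 - _ in e1; set a3 := a2 - _ in e1.
have La3 : L a3 = \sum_(i < 3) inSym (pinv (nth 0 [:: ys; zs; ws] i)) * (c i)%:MP
    + c'%:MP * Y * inSym (pinv ys) + X * L b.
  have a3E i : a3 i 0 = (c i)%:MP + (if i == 0 :> nat then c'%:MP * Y else 0) + X * b i 0.
    by rewrite /a3 mxE a2E [(- _ : 'cV[P]_3) i 0]mxE; ring.
  rewrite /L !big_ord_recl !big_ord0 !a3E /=; ring.
(* Cancelling x^2 leaves L a3 + f12 g3 = 0, which forces the constants to vanish, so x divides the
   whole vector. *)
have [c0 c'0] : (forall i, c i = 0) /\ c' = 0.
  apply: (@dual_constants_eq0 c c' b g3); rewrite -La3; apply: (mulfI (expf_neq0 2 X_neq0)).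
  by rewrite mulrDr -f12_scale (d1_col_eq0 e1) subrr mulr0.
have a3E : a3 = X *: b.
  apply/colP=> i; rewrite /a3 mxE a2E [(- _ : 'cV[P]_3) i 0]mxE c0 c'0 !mpolyC0 mul0r if_same.
  by rewrite [RHS]mxE; ring.
rewrite a3E expr2 -scalerA -scale_col_mx in e1.
exists (col_mx t3 (t + X *: t')), (col_mx b (X *: g3)); split; last first.
  by apply: (scale_mx_inj X_neq0); rewrite scalemxAr e1 scaler0.
rewrite d2_col scale_col_mx add_col_mx -a3E; congr col_mx.
  rewrite mulmxDr -scalemxAr /a3 /a2 /a1.
  move: (A *m t3) (B *m t) (B *m t') => p1 p2 p3.
  by apply/matrixP=> i j; rewrite !mxE; ring.
rewrite mulmxDr -scalemxAr {1}eg {1}eg1 /g3; move: (C *m t3) (D *m t) (D *m t') => p1 p2 p3.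
by apply/matrixP=> i j; rewrite !mxE; ring.
Qed.

(** * Gradings, exactness of [d1] and [d2], and the isometry [theta2] *)

Local Notation d1 := (d1 Phi x y z w).
Local Notation d2 := (d2 Phi xs x y z w).

(** Three cubics and six quadrics. The cubics share the degree 3 with the last eight generators of
    the next module, which leaves room for the constants in B. *)
Definition deg_F1 (i : 'I_(3 + 6)) : nat := if (i < 3)%N then 3 else 2.
Definition deg_F2 (j : 'I_(8 + 8)) : nat := if (j < 8)%N then 4 else 3.

Lemma mxA_homog i j : A i j \is 1.-homog.
Proof.
have H t u nu : acoef t u nu \is 1.-homog.
  by apply: rpredB; apply: (homogM (d := 1) (d' := 0)); rewrite ?inSym_homog ?homog_mpolyC.
by rewrite mxAE; case: j => [[|[|[|[|[|[|[|[|?]]]]]]]]] // h /=;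
  first [exact: H|apply: rpredB; exact: H].
Qed.

Lemma S_homog r a b : S r a b \is 0.-homog.
Proof. by rewrite sym2P.unlock homog_mpolyC. Qed.

Lemma mxC_homog i j : C i j \is 0.-homog.
Proof.
by rewrite mxCE; case: j => [[|[|[|[|[|[|[|[|?]]]]]]]]] // h /=;
  first [apply: rpredB; exact: S_homog|rewrite rpredN; exact: S_homog].
Qed.

Lemma mxD_homog i j : D i j \is 1.-homog.
Proof.
have H u a b : inSym u * S i a b \is 1.-homog.
  by apply: (homogM (d := 1) (d' := 0)); rewrite ?inSym_homog ?S_homog.
have H' u a b a' b' : inSym u * (S i a b - S i a' b') \is 1.-homog.
  by apply: (homogM (d := 1) (d' := 0)); rewrite ?rpredB ?inSym_homog ?S_homog.
rewrite mxDE /dcoef_y /dcoef_z /dcoef_w.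
by case: j => [[|[|[|[|[|[|[|[|?]]]]]]]]] // h /=;
  first [apply: rpredD; [apply: rpredB|]|apply: rpredB; [apply: rpredD|]];
  first [exact: H|exact: H'].
Qed.

Lemma mxB_homog i j : B i j \is 0.-homog.
Proof. by rewrite mxBE homog_mpolyC. Qed.

(** The blocks are general so that the lemma serves [d2] before and after the base change. *)
Lemma homogeneous_block d (A' : 'M[P]_(3, 8)) (D' : 'M[P]_(6, 8)) (C' : 'M[P]_(6, 8)) :
  (forall i j, A' i j \is 1.-homog) -> (forall i j, C' i j \is 2.-homog) ->
  (forall i j, D' i j \is 1.-homog) -> d = block_mx A' B C' D' ->
  homogeneous_mx deg_F1 deg_F2 d.
Proof.
move=> hA hC hD -> i j; right; rewrite /deg_F1 /deg_F2.
case: (split_ordP i) => i' ->; case: (split_ordP j) => j' ->;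
  rewrite ?(block_mxEul, block_mxEur, block_mxEdl, block_mxEdr) /= ?ltn_ord.
- by split=> //; apply: hA.
- by split=> //; apply: mxB_homog.
- by split=> //; apply: hC.
- by split=> //; apply: hD.
Qed.

Lemma d2_homogeneous : homogeneous_mx deg_F1 deg_F2 d2.
Proof.
apply: (homogeneous_block mxA_homog _ mxD_homog erefl) => i j; rewrite mxE.
apply: (homogM (d := 2) (d' := 0)); last exact: mxC_homog.
by rewrite expr2; apply: (homogM (d := 1) (d' := 1)); apply: inSym_homog.
Qed.

Lemma exact_d1_d2 : exact_at d1 d2.
Proof.
move=> v; split=> [|[t ->]]; last by rewrite mulmxA d1_d2 mul0mx.
exact: (graded_nakayama d2_homogeneous (inSym_homog x) syzygy_step).
Qed.

Local Notation T1 := (theta1 Phi xs x y z w alpha).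
Local Notation T2 := (theta2 Phi x y z w alpha).
Local Notation M := (mxM Phi x y z w alpha).

Lemma mxME i j (a := fun i j : nat => A (inord i) (inord j)) : M i j = (alpha^-1)%:MP *
  nth 0 (nth [::]
   [:: [:: 0; - a 2 0; a 1 0; 0; 0; 0; 0; 0];
       [:: a 2 0; 0; a 2 2; a 2 3; a 2 4; a 2 5; a 2 6; a 2 7];
       [:: - a 1 0; - a 1 1; 0; - a 1 3; - a 1 4; - a 1 5; - a 1 6; - a 1 7];
       [:: 0; - a 2 3; a 1 3; 0; 0; 0; 0; 0];
       [:: 0; - a 2 4; a 1 4; 0; 0; 0; 0; 0];
       [:: 0; - a 2 5; a 1 5; 0; 0; 0; 0; 0];
       [:: 0; - a 2 6; a 1 6; 0; 0; 0; 0; 0];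
       [:: 0; - a 2 7; a 1 7; 0; 0; 0; 0; 0]] i) j.
Proof. by rewrite mxE [X in _ * X]mxE. Qed.

(** The listed entries are visibly skew except for one pair, which [mxA_diag] matches. *)
Lemma mxM_skew : M^T = - M.
Proof.
have e : A (inord 1) (inord 1) = A (inord 2) (inord 2).
  by apply: mxA_diag; rewrite inordK.
apply/matrixP=> i j; rewrite mxE [RHS]mxE !mxME e -mulrN; congr (_ * _).
case: i j => [[|[|[|[|[|[|[|[|?]]]]]]]]] // hi [[|[|[|[|[|[|[|[|?]]]]]]]]] // hj /=;
  by rewrite ?oppr0 ?opprK.
Qed.

Lemma T2_unit : T2 \in unitmx.
Proof. exact: unipotent_unit. Qed.

Lemma T2_isometry : T2 *m hyperbolic 8 *m T2^T = hyperbolic 8.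
Proof. exact: unipotent_isometry mxM_skew. Qed.

(** * Splitting off the trivial summands *)

(** B picks out rows 1 and 2 of M, which hold rows 2 and 1 of A divided by [alpha], up to sign.
    Where M was given a zero to stay skew, [mxA_zero] shows that A has a zero too. *)
Lemma theta2_rows i j : (A + B *m M) i j = if i == 0 :> nat then A i j else 0.
Proof.
have ai (p : P) : alpha%:MP * ((alpha^-1)%:MP * p) = p.
  by rewrite mulrA -mpolyCM divff // mpolyC1 mul1r.
have BM : (B *m M) i j = if i == 1 :> nat then alpha%:MP * M (inord 2) j
    else if i == 2 :> nat then - (alpha%:MP * M (inord 1) j) else 0.
  have [e1 e2] : inord 1 = lift ord0 ord0 :> 'I_8 /\ inord 2 = lift ord0 (lift ord0 ord0) :> 'I_8.
    by split; apply: val_inj; rewrite /= inordK.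
  rewrite e1 e2 mxE !big_ord_recl big_ord0 !mxBE /=.
  by case: i => [[|[|[|?]]]] // H /=; rewrite ?(mpolyC0, mpolyCN); ring.
rewrite mxE BM !mxME !ai !inordK // -[in A i j](inord_val i) -[in A _ j](inord_val j).
case: i {BM} => [[|[|[|?]]]] // hi; rewrite /= ?addr0 //;
  case: j => [[|[|[|[|[|[|[|[|?]]]]]]]]] // hj /=;
  rewrite ?opprK ?oppr0 ?addr0 ?subrr ?addNr ?addrN //.
all: by apply: mxA_zero; rewrite inordK.
Qed.

Lemma mulVal (p : P) : (alpha^-1)%:MP * (alpha%:MP * p) = p.
Proof. by rewrite mulrA -mpolyCM mulVf // mpolyC1 mul1r. Qed.

Lemma T1_unit : T1 \in unitmx.
Proof.
rewrite unitmxE det_lblock det1 mulr1 -unitmxE.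
set T := \matrix_(i, j) _; pose al : P := alpha%:MP; pose be : P := (alpha^-1)%:MP.
pose T' : 'M[P]_3 := \matrix_(i < 3, j < 3) nth 0 (nth [::]
   [:: [:: 1; 0; 0]; [:: 0; 0; - be]; [:: 0; be; 0]] i) j.
have TE i j : T i j = nth 0 (nth [:: ] [:: [:: 1; 0; 0]; [:: 0; 0; al]; [:: 0; - al; 0]] i) j.
  by rewrite mxE.
have T'E i j : T' i j = nth 0 (nth [:: ] [:: [:: 1; 0; 0]; [:: 0; 0; - be]; [:: 0; be; 0]] i) j.
  by rewrite mxE.
have ba : be * al = 1 by rewrite /be /al -mpolyCM mulVf // mpolyC1.
have e : T' *m T = 1%:M.
  apply/matrixP=> i j; rewrite [RHS]mxE mxE !big_ord_recl big_ord0 !T'E !TE -val_eqE.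
  case: i j => [[|[|[|?]]]] // hi [[|[|[|?]]]] // hj /=;
    rewrite ?mulNr ?mulrN ?opprK ?(mulr0, mul0r, mul1r, add0r, addr0, oppr0) ?ba //.
exact: (proj2 (mulmx1_unit e)).
Qed.

Definition red_d2 : 'M[P]_(3 + 6, 8 + 8) := invmx T1 *m d2 *m T2.

(** Multiplying back by [T1] avoids an explicit inverse; [T1_mul] then solves for the rows. *)
Lemma T1_red_d2 : T1 *m red_d2 =
  block_mx (A + B *m M) B (X ^+ 2 *: C + D *m M) D.
Proof.
rewrite /red_d2 -!mulmxA mulKVmx ?T1_unit // /d2 /theta2 mulmx_block.
by rewrite !mulmx1 !mulmx0 !add0r.
Qed.

Lemma red_d2_isotropic : red_d2 *m hyperbolic 8 *m red_d2^T = 0.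
Proof.
have -> : red_d2 *m hyperbolic 8 *m red_d2^T =
    invmx T1 *m (d2 *m (T2 *m hyperbolic 8 *m T2^T) *m d2^T) *m (invmx T1)^T.
  by rewrite /red_d2 !trmx_mul !mulmxA.
by rewrite T2_isometry d2_isotropic mulmx0 mul0mx.
Qed.

Lemma T1_mul q (N : 'M[P]_(3 + 6, q)) j (n := fun b : nat => N (lshift 6 (inord b)) j) :
  [/\ (T1 *m N) (lshift 6 (inord 0)) j = n 0, (T1 *m N) (lshift 6 (inord 1)) j = alpha%:MP * n 2,
      (T1 *m N) (lshift 6 (inord 2)) j = - (alpha%:MP * n 1) &
      forall r, (T1 *m N) (rshift 3 r) j =
        D r (inord 1) * n 1 + D r (inord 2) * n 2 + N (rshift 3 r) j].
Proof.
rewrite /n -[N]vsubmxK /theta1 mul_block_col mul0mx mul1mx addr0.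
have e0 : inord 0 = ord0 :> 'I_3 by apply: val_inj; rewrite /= inordK.
have e1 : inord 1 = lift ord0 ord0 :> 'I_3 by apply: val_inj; rewrite /= inordK.
have e2 : inord 2 = lift ord0 (lift ord0 ord0) :> 'I_3 by apply: val_inj; rewrite /= inordK.
move: (usubmx N) (dsubmx N) => u v; rewrite !col_mxEu.
set T := \matrix_(i, j) _; pose al : P := alpha%:MP.
have TE a b : T a b = nth 0 (nth [:: ] [:: [:: 1; 0; 0]; [:: 0; 0; al]; [:: 0; - al; 0]] a) b.
  by rewrite mxE.
set Dl := row_mx _ _.
have L0 r : Dl r ord0 = 0.
  have -> : ord0 = lshift 2 0 :> 'I_(1 + 2) by apply: val_inj.
  by rewrite /Dl row_mxEl mxE.
have L1 r : Dl r (lift ord0 ord0) = D r (inord 1).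
  have -> : lift ord0 ord0 = rshift 1 (lshift 1 0) :> 'I_(1 + (1 + 1)) by apply: val_inj.
  by rewrite /Dl row_mxEr row_mxEl mxE.
have L2 r : Dl r (lift ord0 (lift ord0 ord0)) = D r (inord 2).
  have -> : lift ord0 (lift ord0 ord0) = rshift 1 (rshift 1 0) :> 'I_(1 + (1 + 1))
    by apply: val_inj.
  by rewrite /Dl row_mxEr row_mxEr mxE.
split=> [||| r]; rewrite ?col_mxEd.
- by rewrite mxE !big_ord_recl big_ord0 !TE e0 /=; ring.
- by rewrite mxE !big_ord_recl big_ord0 !TE e1 e2 /= /al; ring.
- by rewrite mxE !big_ord_recl big_ord0 !TE e1 e2 /= /al; ring.
- by rewrite mxE [X in X + _]mxE !big_ord_recl big_ord0 L0 L1 L2 e1 e2; ring.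
Qed.

(** By [theta2_rows] the left halves of rows 1 and 2 vanish, and the constants of B in the right
    halves cancel those of [theta1]. *)
Lemma red_d2_rows j : [/\
  red_d2 (lshift 6 (inord 1)) j = (j == rshift 8 (inord 1))%:R,
  red_d2 (lshift 6 (inord 2)) j = (j == rshift 8 (inord 2))%:R &
  red_d2 (lshift 6 (inord 0)) j = match split j with inl l => A (inord 0) l | inr _ => 0 end].
Proof.
have [r0 r1 r2 _] := T1_mul red_d2 j; move: r0 r1 r2.
rewrite T1_red_d2; case: (split_ordP j) => l ->; rewrite ?(block_mxEul, block_mxEur).
  rewrite !theta2_rows !inordK //= => <- /esym e1 /esym e2.
  rewrite -(mulVal (red_d2 (lshift 6 (inord 1)) _)) -(mulVal (red_d2 (lshift 6 (inord 2)) _)).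
  move/eqP: e2; rewrite oppr_eq0 => /eqP ->; rewrite e1 !mulr0.
  by rewrite !eq_lrshift.
rewrite !mxBE !inordK //= mpolyC0 => <- e1 e2; split=> //; last first.
- rewrite -(mulVal (red_d2 _ _)) -e1 eq_rshift -val_eqE /= inordK //.
  by case: eqP => _; rewrite ?mpolyC0 ?mulr0 // -mpolyCM mulVf.
- rewrite -(mulVal (red_d2 _ _)) -[_ * red_d2 _ _]opprK -e2 eq_rshift -val_eqE /= inordK //.
  by case: eqP => _; rewrite ?mpolyC0 ?oppr0 ?mulr0 // mpolyCN opprK -mpolyCM mulVf.
Qed.

Lemma red_d2_bottom r j : j \notin [:: rshift 8 (inord 1); rshift 8 (inord 2)] ->
  red_d2 (rshift 3 r) j = block_mx A B (X ^+ 2 *: C + D *m M) D (rshift 3 r) j.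
Proof.
rewrite !inE negb_or => /andP[j1 j2]; have [_ _ _ e] := T1_mul red_d2 j.
have [r1 r2 _] := red_d2_rows j.
move: (e r); rewrite r1 r2 (negPf j1) (negPf j2) !mulr0 !add0r => <-.
by rewrite T1_red_d2; case: (split_ordP j) => l ->; rewrite ?(block_mxEdl, block_mxEdr).
Qed.

(** The columns of D placed in [theta1] already produce this column of the product, so nothing is
    left for the lower rows. *)
Lemma red_d2_unit_col r b : b \in [:: 1; 2]%N -> red_d2 (rshift 3 r) (rshift 8 (inord b)) = 0.
Proof.
move=> hb; have [_ _ _ e] := T1_mul red_d2 (rshift 8 (inord b)).
have [r1 r2 _] := red_d2_rows (rshift 8 (inord b)).
move: (e r); rewrite r1 r2 T1_red_d2 block_mxEdr !eq_rshift -!val_eqE /=.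
move: hb; rewrite !inE => /orP[] /eqP ->; rewrite !inordK //= ?mulr0 ?mulr1 ?addr0 ?add0r.
  by move/eqP; rewrite -subr_eq0 opprD addrA subrr sub0r oppr_eq0 => /eqP.
by move/eqP; rewrite -subr_eq0 opprD addrA subrr sub0r oppr_eq0 => /eqP.
Qed.

Lemma red_d2_isotropicE i i' : \sum_j red_d2 i j * red_d2 i' (swap_halves j) = 0.
Proof.
have := congr1 (fun N : 'M_(_, _) => N i i') red_d2_isotropic.
rewrite -mulmxA mxE [RHS]mxE => e; rewrite -[RHS]e; apply: eq_bigr => j _.
by rewrite swap_halves_mul [X in _ = _ * X]mxE.
Qed.

Lemma swap_rshift n (j : 'I_n) : swap_halves (rshift n j) = lshift n j.
Proof.
by rewrite /swap_halves; case: split_ordP => l /eqP; rewrite ?eq_rlshift // eq_rshift => /eqP ->.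
Qed.

Lemma swap_lshift n (j : 'I_n) : swap_halves (lshift n j) = rshift n j.
Proof.
by rewrite /swap_halves; case: split_ordP => l /eqP; rewrite ?eq_lrshift // eq_lshift => /eqP ->.
Qed.

(* Row b of red_d2 is a unit vector, so the isotropy of the rows forces the
   opposite column to vanish. *)
Lemma red_d2_zero_col i b : b \in [:: 1; 2]%N -> red_d2 i (lshift 8 (inord b)) = 0.
Proof.
move=> hb; have /esym := red_d2_isotropicE i (lshift 6 (inord b)).
rewrite (bigD1 (lshift 8 (inord b))) //= swap_lshift.
have rb j : red_d2 (lshift 6 (inord b)) j = (j == rshift 8 (inord b))%:R.
  by have [r1 r2 _] := red_d2_rows j; move: hb; rewrite !inE => /orP[] /eqP ->.
rewrite rb eqxx mulr1 big1 ?addr0 // => j hj; rewrite rb.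
have -> : (swap_halves j == rshift 8 (inord b)) = false; last by rewrite mulr0.
apply: contraNF hj; case: (split_ordP j) => l ->; rewrite ?swap_lshift ?swap_rshift.
  by rewrite eq_rshift eq_lshift.
by rewrite eq_lrshift.
Qed.

(** Deleted columns of the left half vanish by isotropy, those of the right half by the choice of
    [theta1]. *)
Lemma red_d2_supp i j : j \notin codom keep12 -> red_d2 (keep7 i) j = 0.
Proof.
move/keep12_codom => hj.
have [b hb ej] : exists2 b, b \in [:: 1; 2]%N & j = lshift 8 (inord b) \/ j = rshift 8 (inord b).
  move: hj; rewrite !inE => /or4P[] /eqP hj; [exists 1%N|exists 2%N|exists 1%N|exists 2%N] => //;
    [left|left|right|right]; apply: val_inj; by rewrite /= hj inordK.
case: ej => ->; first exact: red_d2_zero_col.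
have [i0|i0] := eqVneq (i : nat) 0%N.
  have -> : keep7 i = lshift 6 (inord 0) by apply: val_inj; rewrite /= keep7E i0 inordK.
  have [_ _ ->] := red_d2_rows (rshift 8 (inord b)).
  by case: split_ordP => l // /eqP; rewrite eq_rlshift.
have [r ->] : exists r, keep7 i = rshift 3 r.
  exists (inord i.-1); apply: val_inj; rewrite /= keep7E inordK;
  by case: i i0 => [[|[|[|[|[|[|[|?]]]]]]]].
exact: red_d2_unit_col.
Qed.

(** A column of [red_d2] is the unit vector at i, and [d1 *m T1] kills it. *)
Lemma d1_T1_supp i : i \notin codom keep7 -> (d1 *m T1) 0 i = 0.
Proof.
move/keep7_codom; move eb : (i : nat) => b hb.
have ei : i = lshift 6 (inord b).
  by apply: val_inj; rewrite /= eb inordK //; move: hb; rewrite !inE => /orP[] /eqP ->.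
have e : d1 *m T1 *m red_d2 = 0.
  by rewrite /red_d2 !mulmxA mulmxK ?T1_unit // d1_d2 mul0mx.
have colE l : red_d2 l (rshift 8 (inord b)) = (l == i)%:R.
  have [r1 r2 r0] := red_d2_rows (rshift 8 (inord b)).
  case: (split_ordP l) => l' -> {l}; last first.
    by rewrite red_d2_unit_col // ei eq_rlshift.
  rewrite ei eq_lshift -[l']inord_val; move: hb; rewrite !inE.
  case: l' => [[|[|[|?]]]] // hl /orP[] /eqP eb'; move: r0 r1 r2; rewrite eb' => r0 r1 r2;
    rewrite /= ?r0 ?r1 ?r2 ?eq_rshift -?val_eqE /= ?inordK //;
    by case: split_ordP => l // /eqP; rewrite eq_rlshift.
have := congr1 (fun N : 'rV_(8 + 8) => N 0 (rshift 8 (inord b))) e.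
rewrite mxE [RHS]mxE (bigD1 i) //= big1 => [|l li].
  by rewrite addr0 colE eqxx mulr1.
by rewrite colE (negPf li) mulr0.
Qed.

(** * The reduced complex and the final resolution *)

Local Notation E1 := (E1 Phi xs x y z w alpha).
Local Notation E2 := (E2 Phi xs x y z w alpha).
Local Notation E3 := (E3 Phi xs x y z w alpha).
Local Notation E4 := (E4 Phi xs x y z w alpha).

Lemma exact_E1_E2 : exact_at E1 E2.
Proof.
apply: exact_submx; [exact: keep7_inj|exact: keep12_inj|exact: d1_T1_supp|exact: red_d2_supp|].
exact: exact_at_units T1_unit T2_unit exact_d1_d2.
Qed.

Lemma ann_E1 f : ann Phi f <-> exists u : 'cV[P]_7, f%:M = E1 *m u.
Proof.
rewrite -(colsub_image keep7_inj d1_T1_supp) ann_imd1; split=> [[u eu]|[u eu]].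
  by exists (invmx T1 *m u); rewrite mulmxA mulmxK ?T1_unit.
by exists (T1 *m u); rewrite mulmxA.
Qed.

(** The isotropy sum over 16 indices restricts to the 12 kept ones, which the swap preserves. *)
Lemma E2_E3 : E2 *m E3 = 0.
Proof.
apply/matrixP=> i i'; rewrite [RHS]mxE -(red_d2_isotropicE (keep7 i) (keep7 i')) mxE.
rewrite [RHS](sum_codom keep12_inj) => [|j hj]; last by rewrite red_d2_supp ?mul0r.
apply: eq_bigr => j _; rewrite /Defs.E3 /mxJ swap_halves_mul mxE [X in _ * X]mxE.
by rewrite [X in _ * X]mxE keep12_swap.
Qed.

(** The kept columns of [theta1] are unit vectors, so E1 consists of unchanged entries of [d1]. *)
Lemma T1_keep7 l i : T1 l (keep7 i) = (l == keep7 i)%:R.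
Proof.
have [] := T1_mul 1%:M (keep7 i); rewrite mulmx1.
have n12 b : b \in [:: 1; 2]%N -> (1%:M : 'M[P]_(3 + 6)) (lshift 6 (inord b)) (keep7 i) = 0.
  move=> hb; rewrite mxE -val_eqE /= keep7E inordK; last first.
    by move: hb; rewrite !inE => /orP[] /eqP ->.
  by move: hb; rewrite !inE => /orP[] /eqP ->; case: i => [[|[|[|[|[|[|[|?]]]]]]]].
rewrite (n12 1%N) // (n12 2%N) // !mulr0 oppr0 => t0 t1 t2 t3.
case: (split_ordP l) => l' -> {l}; last by rewrite t3 ?n12 // ?mulr0 ?add0r ?mxE.
case: l' => [[|[|[|?]]]] // h.
- by rewrite (_ : Ordinal h = inord 0) ?t0 ?mxE //; apply: val_inj; rewrite /= inordK.
- rewrite (_ : Ordinal h = inord 1) ?t1; last by apply: val_inj; rewrite /= inordK.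
  by have := n12 1%N isT; rewrite mxE => ->.
- rewrite (_ : Ordinal h = inord 2) ?t2; last by apply: val_inj; rewrite /= inordK.
  by have := n12 2%N isT; rewrite mxE => ->.
Qed.

Lemma d1_homog i : d1 0 i \is (deg_F1 i).-homog.
Proof.
have hM (a b : U) : inSym a * inSym b \is 2.-homog.
  by apply: (homogM (d := 1) (d' := 1)); apply: inSym_homog.
rewrite /deg_F1 /Defs.d1; case: (split_ordP i) => l ->; rewrite ?row_mxEl ?row_mxEr /= ?ltn_ord.
  by rewrite mxE f11E; apply: (homogM (d := 1) (d' := 2)); rewrite ?inSym_homog ?hM.
by rewrite f12E; case: l => [[|[|[|[|[|[|?]]]]]]] // h /=; apply: rpredB; exact: hM.
Qed.

Lemma E1E i : E1 0 i = d1 0 (keep7 i).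
Proof.
rewrite /Defs.E1 mxE mxE (bigD1 (keep7 i)) //= T1_keep7 eqxx mulr1 big1 ?addr0 // => l li.
by rewrite T1_keep7 (negPf li) mulr0.
Qed.

Lemma mxM_homog i j : M i j \is 1.-homog.
Proof.
rewrite mxME; apply: (homogM (d := 0) (d' := 1)); first exact: homog_mpolyC.
have h a b : A a b \is 1.-homog by exact: mxA_homog.
have h0 : (0 : P) \is 1.-homog by exact: rpred0.
case: i j => [[|[|[|[|[|[|[|[|?]]]]]]]]] // hi [[|[|[|[|[|[|[|[|?]]]]]]]]] // hj /=;
  by rewrite ?rpredN ?h ?h0.
Qed.

(** On the kept columns rows 1 and 2 of [red_d2] vanish, so [T1] does not alter the kept rows
    there. *)
Lemma E2E i j : E2 i j =
  block_mx (A + B *m M) B (X ^+ 2 *: C + D *m M) D (keep7 i) (keep12 j).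
Proof.
rewrite mxE -/(red_d2); have [i0|i0] := eqVneq (i : nat) 0%N.
  have -> : keep7 i = lshift 6 (inord 0) by apply: val_inj; rewrite /= keep7E i0 inordK.
  have [_ _ ->] := red_d2_rows (keep12 j).
  case: split_ordP => l ->; rewrite ?(block_mxEul, block_mxEur).
    by rewrite theta2_rows inordK.
  by rewrite mxBE inordK //= mpolyC0.
have [r ->] : exists r, keep7 i = rshift 3 r.
  exists (inord i.-1); apply: val_inj; rewrite /= keep7E inordK;
  by case: i i0 => [[|[|[|[|[|[|[|?]]]]]]]].
rewrite red_d2_bottom.
  by case: (split_ordP (keep12 j)) => l ->; rewrite ?(block_mxEdl, block_mxEdr).
have h b : b \in [:: 1; 2]%N -> keep12 j != rshift 8 (inord b).
  move=> hb; rewrite -val_eqE /= keep12E inordK; last first.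
    by move: hb; rewrite !inE => /orP[] /eqP ->.
  by move: hb; rewrite !inE => /orP[] /eqP ->; case: j => [[|[|[|[|[|[|[|[|[|[|[|[|?]]]]]]]]]]]]].
by rewrite !inE !(negPf (h _ _)).
Qed.

Lemma E2_homogeneous : homogeneous_mx (deg_F1 \o keep7) (deg_F2 \o keep12) E2.
Proof.
move=> i j; rewrite E2E; apply: homogeneous_block => [a b|a b|a b|//].
- rewrite theta2_rows; case: ifP => _; [exact: mxA_homog|exact: rpred0].
- rewrite mxE; apply: rpredD.
    rewrite mxE; apply: (homogM (d := 2) (d' := 0)); last exact: mxC_homog.
    by rewrite expr2; apply: (homogM (d := 1) (d' := 1)); apply: inSym_homog.
  rewrite mxE; apply: rpred_sum => l _.
  by apply: (homogM (d := 1) (d' := 1)); [exact: mxD_homog|exact: mxM_homog].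
- exact: mxD_homog.
Qed.

(** Entries of positive degree have no constant term. Degree 0 occurs only for the kept cubic,
    against the right-hand columns, and there row 0 of B is zero. *)
Lemma E2_minimal : minimal_mx E2.
Proof.
move=> i j; have [->|[_ h]] := E2_homogeneous i j; first by rewrite mcoeff0.
have [lt|] := boolP (deg_F1 (keep7 i) < deg_F2 (keep12 j))%N.
  by rewrite (homog_coeff0 h) // subn_gt0.
rewrite /deg_F1 /deg_F2 => hij.
have ki : (keep7 i < 3)%N by apply: contraNT hij => /negPf ->; case: ifP.
have kj : ~~ (keep12 j < 8)%N by apply: contraNN hij => ->; case: ifP.
rewrite E2E; case: (split_ordP (keep12 j)) kj => l -> /=; rewrite ?ltn_ord // => _.
have -> : keep7 i = lshift 6 (inord 0).
  by apply: val_inj; move: ki; rewrite /= keep7E inordK //;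
    case: i {h hij} => [[|[|[|[|[|[|[|?]]]]]]]].
by rewrite block_mxEur mxBE inordK //= mpolyC0 mcoeff0.
Qed.

Lemma E3E i j : E3 i j = E2 j (swap_halves i).
Proof. by rewrite /Defs.E3 /mxJ swap_halves_mul mxE. Qed.

Lemma deg_F1_le i : (2 <= deg_F1 i <= 3)%N.
Proof. by rewrite /deg_F1; case: ifP. Qed.

Lemma deg_F2_swap j : deg_F2 (swap_halves j) = (7 - deg_F2 j)%N.
Proof.
by case: (split_ordP j) => l ->; rewrite ?swap_lshift ?swap_rshift /deg_F2 /= ltn_ord.
Qed.

Lemma deg_F2_le j : (3 <= deg_F2 j <= 4)%N.
Proof. by rewrite /deg_F2; case: ifP. Qed.

Lemma minimal_resolution : minimal_homogeneous_resolution4 (ann Phi) E1 E2 E3 E4.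
Proof.
have s_pos : (0 < \dim {:U})%N by rewrite dimU.
(* [Phi] lives in degree 3, so degree 4 starts the descent. *)
have homog_I f : f \is 4.-homog -> ann Phi f by exact: (ann_homog_gt Phi_deg).
have JJ : mxJ U *m mxJ U = 1%:M.
  by rewrite /mxJ mulmx_block !(mul0mx, mulmx0, mulmx1, add0r, addr0) -scalar_mx_block.
have [[sx sy] sz] := (inSym_homog x, inSym_homog y, inSym_homog z).
have E1_homog i : E1 0 i \is (deg_F1 (keep7 i)).-homog by rewrite E1E d1_homog.
split; first 1 last.
- split.
  + move=> i j; rewrite ord1 (homog_coeff0 (E1_homog j)) //.
    by case/andP: (deg_F1_le (keep7 j)) => /ltnW.
  + exact: E2_minimal.
  + by move=> i j; rewrite E3E E2_minimal.
  + move=> i j; rewrite mxE ord1 (homog_coeff0 (E1_homog i)) //.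
    by case/andP: (deg_F1_le (keep7 i)) => /ltnW.
- exact: ann_E1.
- split; first exact: exact_E1_E2.
  + move=> v; split=> [|[u ->]]; last by rewrite mulmxA E2_E3 mul0mx.
    exact: (ker_E2 (erefl : (6 + 6)%N = (6 + 6)%N) JJ exact_E1_E2 E2_E3 sx sy sz X_neq0
      regular_y regular_z ann_E1 homog_I s_pos).
  + move=> v; split=> [|[u ->]].
      exact: (ker_E3 JJ exact_E1_E2 sx sy sz X_neq0 regular_y ann_E1 homog_I s_pos).
    by rewrite mulmxA (E3E4 _ exact_E1_E2) mul0mx.
- move=> v Ev; apply: (E4_inj ann_E1 homog_I s_pos); by rewrite Ev mulmx0.
(* The last shift 7 is the socle degree 3 plus the number 4 of variables; duality replaces a degree
   d by 7 - d. *)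
- exists (deg_F1 \o keep7), (deg_F2 \o keep12),
    (fun i => 7 - deg_F1 (keep7 i))%N, (fun=> 7%N); split.
  + by move=> i j; right; rewrite ord1 subn0.
  + exact: E2_homogeneous.
  + move=> i j; rewrite E3E; have [->|[_ h]] := E2_homogeneous j (swap_halves i); [by left|right].
    move: h; rewrite /= keep12_swap deg_F2_swap subnAC => h; split=> //.
    have /andP[_ le1] := deg_F1_le (keep7 j); have /andP[_ le2] := deg_F2_le (keep12 i).
    exact: leq_trans le2 (leq_sub2l 7 le1).
  + move=> i j; right; rewrite mxE ord1; case/andP: (deg_F1_le (keep7 i)) => _ le.
    by rewrite leq_subr subKn ?E1_homog // (leq_trans le).
Qed.

End Complex.

Theorem theorem10p3 (k : fieldType) (U : vectType k)
    (Phi3 : {linear {mpoly k[\dim {:U}]} -> k^o})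
    (x y z w : U) (xs : 'Hom(U, k^o)) (alpha : k)
    (dimU : \dim {:U} = 4%N)
    (Phi3_deg : in_D 3 Phi3)
    (no_linear : forall u : U, u != 0 -> ~ ann Phi3 (inSym u))
    (wl : weak_Lefschetz Phi3 x)
    (xs_x : xs x = 1)
    (yzw_basis : basis_of (lker xs) [:: y; z; w])
    (SM_rank : \rank (SM Phi3 x y z w) = 1%N)
    (SM_eq : SM Phi3 x y z w
             = \matrix_(i < 3, j < 3) (if (i == ord0) && (j == ord0) then alpha else 0))
    (alpha_neq0 : alpha != 0) :
  minimal_homogeneous_resolution4 (ann Phi3)
    (E1 Phi3 xs x y z w alpha)
    (E2 Phi3 xs x y z w alpha)
    (E3 Phi3 xs x y z w alpha)
    (E4 Phi3 xs x y z w alpha).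
Proof. exact: minimal_resolution. Qed.
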